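(* Assume that $\mathfrak{a}$ is an abelian Lie algebra of dimension $d_1$ (with underlying space $\mathbb{C}^{d_1}$), and $[\lambda]$ is a critical point of $F_m:S_m\to\mathbb{R}$ of type $(k_2<\cdots<k_r;d_2,\dots,d_r)$ where $k_2>0$, with $\mathrm{M}_\lambda=c_\lambda I+D_\lambda$, $c_\lambda\in\mathbb{R}$, $D_\lambda\in\mathrm{Der}(\lambda)$. Consider the direct sum $\mu=\mathfrak{a}\ltimes_\rho\lambda$, where $\rho=(L^\rho,R^\rho)$, and $L^\rho:\mathbb{C}^{d_1}\times\mathbb{C}^m\to\mathbb{C}^m$, $R^\rho:\mathbb{C}^m\times\mathbb{C}^{d_1}\to\mathbb{C}^m$ are bilinear mappings such that $\mu$ is a symmetric Leibniz algebra on $\mathbb{C}^{d_1}\oplus\mathbb{C}^m$ with bracket relations given by $$\mu(A+X,B+Y):=L^\rho_A(Y)+R^\rho_B(X)+\lambda(X,Y)$$ for all $A,B\in\mathbb{C}^{d_1}$, $X,Y\in\mathbb{C}^m$. Assume that the following conditions are satisfied: (i) $[D_\lambda,L^\rho_A]=0$ and $[D_\lambda,R^\rho_A]=0$ for all $A\in\mathbb{C}^{d_1}$. (ii) $[L^\rho_A,(L^\rho_A)^*]=0$ and $[R^\rho_A,(R^\rho_A)^*]=0$ for all $A\in\mathbb{C}^{d_1}$; and for each $0\neq A\in\mathbb{C}^{d_1}$, $L^\rho_A$ or $R^\rho_A$ is not zero. If we extend the Hermitian inner product on $\mathbb{C}^m$ to $\mathbb{C}^{d_1}\oplus\mathbb{C}^m$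 (with the two summands orthogonal) by setting $$\langle A,B\rangle=-\frac{2}{c_\lambda}\left(\operatorname{tr}L^\rho_A(L^\rho_B)^*+\operatorname{tr}R^\rho_A(R^\rho_B)^*\right),\qquad A,B\in\mathbb{C}^{d_1},$$ then $[\mu]$ is a solvable critical point of type $(0<k_2<\cdots<k_r;d_1,d_2,\dots,d_r)$ for $F_n:S_n\to\mathbb{R}$, $n=d_1+m$.
   Context: Let $V_n=\otimes^2(\mathbb{C}^n)^*\otimes\mathbb{C}^n$ be the space of all bilinear maps $\mu:\mathbb{C}^n\times\mathbb{C}^n\to\mathbb{C}^n$. $\mathrm{GL}(n)$ acts on $V_n$ by $g.\mu(X,Y)=g\mu(g^{-1}X,g^{-1}Y)$, and $\mathrm{Der}(\mu)$ is the derivation algebra of $\mu$. Fix a Hermitian inner product on $\mathbb{C}^n$; it induces the Hermitian inner product $\langle\mu,\lambda\rangle=\sum_{i,j,k}\langle\mu(X_i,X_j),X_k\rangle\overline{\langle\lambda(X_i,X_j),X_k\rangle}$ on $V_n$, where $\{X_i\}$ is any orthonormal basis of $\mathbb{C}^n$. On $\mathfrak{gl}(n)$ put $(A,B)=\operatorname{tr}AB^*$, where $^*$ is the conjugate transpose with respect to the fixed inner product; $\mathrm{i}\mathfrak{u}(n)$ is the space of Hermitian operators. The moment map $m:\mathbb{P}V_n\to\mathrm{i}\mathfrak{u}(n)$ is defined by $(m([\mu]),A)=(\mathrm{d}\rho_\mu)_eA/\|\mu\|^2$ for $A\in\mathrm{i}\mathfrak{u}(n)$, where $\rho_\mu(g)=\langle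 g.\mu,g.\mu\rangle$, and $F_n([\mu])=\|m([\mu])\|^2$. With $L^\mu_X(Y)=\mu(X,Y)$, $R^\mu_X(Y)=\mu(Y,X)$, set $\mathrm{M}_\mu=2\sum_iL^\mu_{X_i}(L^\mu_{X_i})^*-2\sum_i(L^\mu_{X_i})^*L^\mu_{X_i}-2\sum_i(R^\mu_{X_i})^*R^\mu_{X_i}$; one has $m([\mu])=\mathrm{M}_\mu/\|\mu\|^2$. It is known that $[\mu]$ is a critical point of $F_n:\mathbb{P}V_n\to\mathbb{R}$ iff $\mathrm{M}_\mu=c_\mu I+D_\mu$ with $c_\mu\in\mathbb{R}$, $D_\mu\in\mathrm{Der}(\mu)$, and that then $c_\mu=\operatorname{tr}\mathrm{M}_\mu^2/\operatorname{tr}\mathrm{M}_\mu<0$. Type: for a critical point $[\mu]$ with $\mathrm{M}_\mu=c_\mu I+D_\mu$ there is a constant $c>0$ such that the eigenvalues of $cD_\mu$ are integers $k_1<\cdots<k_r$ prime to each other, with multiplicities $d_1,\dots,d_r$; the data $(k_1<\cdots<k_r;d_1,\dots,d_r)$ is the type of $[\mu]$. A symmetric Leibniz algebra is an algebra satisfying $x(yz)=(xy)z+y(xz)$ and $(xy)z=(xz)y+x(yz)$ for all $x,y,z$. $S_n\subset\mathbb{P}V_n$ is the projectivization of the algebraic variety of all symmetric Leibniz algebra structures on $\mathbb{C}^n$. The critical points of $F_n:S_n\to\mathbb{R}$ are precisely the critical points of $F_n:\mathbb{P}V_n\to\mathbb{R}$ that lie in $S_n$. An algebra $\mathfrak{l}$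 is solvable if $\mathfrak{l}^{(r)}=0$ for some $r$, where $\mathfrak{l}^{(0)}=\mathfrak{l}$, $\mathfrak{l}^{(k+1)}=\mathfrak{l}^{(k)}\mathfrak{l}^{(k)}$. Notation: $L^\rho_A(Y)=L^\rho(A,Y)$ and $R^\rho_A(X)=R^\rho(X,A)$ are operators on $\mathbb{C}^m$; adjoints $(L^\rho_A)^*,(R^\rho_A)^*$ are taken with respect to the fixed Hermitian inner product on $\mathbb{C}^m$. The space $\mathbb{C}^{d_1}\oplus\mathbb{C}^m$ with the extended inner product plays the role of $\mathbb{C}^n$ with its fixed Hermitian inner product. *)

(* Defs.v *)
From mathcomp Require Import all_boot all_order all_algebra.
From mathcomp Require Import complex.
From mathcomp Require Import boolp classical_sets reals topology normedtype.
From mathcomp Require Import derive.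

Set Implicit Arguments.
Unset Strict Implicit.
Unset Printing Implicit Defensive.

Import Order.TTheory GRing.Theory Num.Theory.
Import numFieldNormedType.Exports.

Local Open Scope classical_set_scope.
Local Open Scope complex_scope.
Local Open Scope ring_scope.

(* C^n is the space of column vectors over R[i], and operators are matrices
   acting on the left. *)

Definition opmx (C : nzRingType) (n p : nat) (f : 'cV[C]_n -> 'cV[C]_p) :
    'M[C]_(p, n) :=
  \matrix_(i, j) f (delta_mx j 0) i 0.

Definition Lop (C : nzRingType) (n p q : nat)
    (f : 'cV[C]_n -> 'cV[C]_p -> 'cV[C]_q) (X : 'cV[C]_n) : 'M[C]_(q, p) :=
  opmx (fun Y => f X Y).

Definition Rop (C : nzRingType) (n p q : nat)
    (f : 'cV[C]_n -> 'cV[C]_p -> 'cV[C]_q) (Y : 'cV[C]_p) : 'M[C]_(q, n) :=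
  opmx (fun X => f X Y).

Section Algebras.
Variables (C : fieldType) (n : nat).
Implicit Types (mu : 'cV[C]_n -> 'cV[C]_n -> 'cV[C]_n) (g D : 'M[C]_n).

Definition act g mu : 'cV[C]_n -> 'cV[C]_n -> 'cV[C]_n :=
  fun X Y => g *m mu (invmx g *m X) (invmx g *m Y).

Definition derivation mu D : Prop :=
  forall X Y, D *m mu X Y = mu (D *m X) Y + mu X (D *m Y).

Definition symmetric_Leibniz mu : Prop :=
  forall x y z,
    mu x (mu y z) = mu (mu x y) z + mu y (mu x z) /\
    mu (mu x y) z = mu (mu x z) y + mu x (mu y z).

(* For bilinear mu, the products of basis vectors of U span the product of U
   with itself (cf. prodv in falgebra). *)
Fixpoint derived_series mu (k : nat) : {vspace 'cV[C]_n} :=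
  if k is k'.+1 then
    let U := derived_series mu k' in
    <<[seq mu x y | x <- vbasis U, y <- vbasis U]>>%VS
  else fullv.

Definition solvable_alg mu : Prop := exists r, derived_series mu r = 0%VS.

End Algebras.

Section Hermitian.
Variables (R : realType) (n : nat).
Local Notation C := R[i].
Variable ip : {dot 'cV[C]_n for Num.conj}.
Implicit Types (mu nu : 'cV[C]_n -> 'cV[C]_n -> 'cV[C]_n) (A B : 'M[C]_n).

Definition adj A : 'M[C]_n :=
  xget 0 [set B | forall X Y, ip (A *m X) Y = ip X (B *m Y)].

(* The columns form an orthonormal basis; nothing below depends on which one
   is chosen. *)
Definition onb : 'M[C]_n :=
  xget 0 [set E | forall i j, ip (col i E) (col j E) = (i == j)%:R].

Local Notation X_ i := (col i onb).

Definition innerV mu nu : C :=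
  \sum_i \sum_j \sum_k
    ip (mu (X_ i) (X_ j)) (X_ k) * Num.conj (ip (nu (X_ i) (X_ j)) (X_ k)).

Definition normV2 mu : R := complex.Re (innerV mu mu).

Definition innerM A B : C := \tr (A *m adj B).

Definition hermitian_op A : Prop := adj A = A.

Definition rho mu (g : 'M[C]_n) : R := normV2 (act g mu).

(* The differential of rho mu at the identity of GL(n): 1 + tA lies in GL(n)
   for small t and has velocity A at t = 0. *)
Definition drho mu A : R :=
  derive1 (fun t : R => rho mu (1%:M + t%:C *: A)) 0.

Definition moment mu : 'M[C]_n :=
  xget 0 [set H | hermitian_op H /\ forall A, hermitian_op A ->
    innerM H A = (drho mu A / normV2 mu)%:C].

(* Points of the projective space of V_n are represented by nonzero mu; F is
   invariant under scaling of mu. *)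
Definition F mu : R := complex.Re (innerM (moment mu) (moment mu)).

(* V_n \ {0} -> PV_n is a submersion, so [mu] is critical iff the lift of F
   has zero derivative at mu in every direction nu of V_n. *)
Definition critical mu : Prop :=
  (exists X Y, mu X Y != 0) /\
  forall nu : {bilinear 'cV[C]_n -> 'cV[C]_n -> 'cV[C]_n},
    is_derive (0 : R) (1 : R)
      (fun t : R => F (fun X Y => mu X Y + t%:C *: nu X Y)) (0 : R).

(* The critical points of F on S_n are those of F on PV_n that lie in S_n. *)
Definition critical_S mu : Prop := symmetric_Leibniz mu /\ critical mu.

Definition Mop mu : 'M[C]_n :=
  2 *: (\sum_i Lop mu (X_ i) *m adj (Lop mu (X_ i)))
  - 2 *: (\sum_i adj (Lop mu (X_ i)) *m Lop mu (X_ i))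
  - 2 *: (\sum_i adj (Rop mu (X_ i)) *m Rop mu (X_ i)).

(* M_mu = c I + D with D a derivation. *)
Definition Mop_decomp mu (c : R) (D : 'M[C]_n) : Prop :=
  derivation mu D /\ Mop mu = (c%:C)%:M + D.

(* The eigenvalues of A are the integers in ks, in increasing order and
   without (global) common factor, with multiplicities ds. *)
Definition integral_spectrum A (ks : seq int) (ds : seq nat) : Prop :=
  [/\ size ds = size ks,
      sorted <%R ks,
      foldr gcdz 0 ks = 1,
      all (fun d => 0 < d)%N ds &
      char_poly A = \prod_(i < size ks)
        ('X - ((nth 0 ks i)%:~R)%:P) ^+ nth 0%N ds i].

Definition has_type mu (ks : seq int) (ds : seq nat) : Prop :=
  exists (c_mu : R) (D_mu : 'M[C]_n), Mop_decomp mu c_mu D_mu /\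
  exists2 c : R, 0 < c & integral_spectrum (c%:C *: D_mu) ks ds.

End Hermitian.

(* Main.v *)
(* Let rho(g) = |g.mu|^2. For Hermitian A one has (d rho)_e A = tr(M_mu A), so
   F(mu) = tr(M_mu^2) / |mu|^4. More precisely tr(Q(mu, nu) A) = 2 <A.mu, nu>
   for the polarization Q of mu |-> M_mu. If M_mu = cI + D with D a derivation,
   then D.mu = 0 and I.mu = -mu; this gives tr(M_mu^2) = -2c |mu|^2 (hence c < 0
   and the uniqueness of c and D), and it makes the derivative of F at mu vanish
   in every direction. So for the extension it suffices to show
   M_mu = c_lambda I + (0 + D_lambda). In an orthonormal basis adapted to
   a + C^m, the block of M_mu on C^m is M_lambda because the operators L_A and
   R_A are normal; the block on a is c_lambda I by the choice of the inner
   product; and the mixed block is made of the inner products (L_X, L_A) and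
   (R_X, R_A), which vanish because D_lambda is Hermitian and invertible and
   commutes with L_A and R_A, while L and R map D_lambda X to [D_lambda, L_X]
   and [D_lambda, R_X]. Finally the product of mu takes values in C^m, and
   the grading of lambda by the positive eigenvalues of D_lambda forces the
   derived series to vanish. *)

Require Import Defs.
From HB Require Import structures.
From mathcomp Require Import all_boot all_order all_algebra.
From mathcomp Require Import complex.
From mathcomp Require Import boolp classical_sets functions reals topology.
From mathcomp Require Import normedtype derive ring lra.

Set Implicit Arguments.
Unset Strict Implicit.
Unset Printing Implicit Defensive.

Import Order.TTheory GRing.Theory Num.Theory.
Import numFieldNormedType.Exports.

Local Open Scope complex_scope.
Local Open Scope ring_scope.

Local Notation "A ^H" := (map_mx Num.conj A^T) (at level 8, format "A ^H").

Lemma mulmx_colE (C : fieldType) n p (A : 'M[C]_(p, n)) (x : 'cV[C]_n) :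
  A *m x = \sum_i x i 0 *: col i A.
Proof.
apply/colP=> k; rewrite mxE summxE; apply: eq_bigr => i _.
by rewrite !mxE mulrC.
Qed.

Lemma mulmx_ext (C : fieldType) n p (A B : 'M[C]_(p, n)) :
  (forall x : 'cV[C]_n, A *m x = B *m x) -> A = B.
Proof.
move=> h; apply/matrixP => i j; have := h (delta_mx j 0).
by rewrite -!colE => /colP /(_ i); rewrite !mxE.
Qed.

(** * Hermitian inner products: orthonormal bases, adjoints, the spectral theorem *)

Section InnerProduct.
Variables (R : realType) (n : nat).
Local Notation C := R[i].
Variable ip : {dot 'cV[C]_n for Num.conj}.
Implicit Types (E A B U : 'M[C]_n) (x y : 'cV[C]_n).

Definition orthonormal_basis E :=
  forall i j, ip (col i E) (col j E) = (i == j)%:R.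

Lemma dotC x y : ip x y = Num.conj (ip y x).
Proof. by rewrite hermC expr0 mul1r. Qed.

Lemma dotDl x y z : ip (x + y) z = ip x z + ip y z.
Proof. exact: linearDl. Qed.

Lemma dotZl (a : C) x z : ip (a *: x) z = a * ip x z.
Proof. exact: linearZl_LR. Qed.

Lemma dotBl x y z : ip (x - y) z = ip x z - ip y z.
Proof. exact: linearBl. Qed.

Lemma dotDr x y z : ip z (x + y) = ip z x + ip z y.
Proof. exact: linearDr. Qed.

Lemma dotZr (a : C) x z : ip z (a *: x) = Num.conj a * ip z x.
Proof. exact: linearZr_LR. Qed.

Lemma dot_suml (I : finType) (u : I -> 'cV[C]_n) z :
  ip (\sum_i u i) z = \sum_i ip (u i) z.
Proof. exact: linear_sumlz. Qed.

Lemma dot_sumr (I : finType) (u : I -> 'cV[C]_n) z :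
  ip z (\sum_i u i) = \sum_i ip z (u i).
Proof. exact: linear_sumr. Qed.

Lemma dot_basis E x y :
  orthonormal_basis E -> ip (E *m x) (E *m y) = (y^H *m x) 0 0.
Proof.
move=> oE; rewrite (mulmx_colE E x) (mulmx_colE E y) dot_suml mxE.
apply: eq_bigr => i _.
rewrite dotZl dot_sumr (bigD1 i) //= big1 => [|j ji].
  by rewrite dotZr oE eqxx mulr1 addr0 !mxE mulrC.
by rewrite dotZr oE eq_sym (negPf ji) mulr0.
Qed.

Lemma dot_gt0 x : x != 0 -> 0 < ip x x.
Proof. exact: neq0_dnorm_gt0. Qed.

Lemma dot_inj x y : (forall z, ip x z = ip y z) -> x = y.
Proof.
move=> h; apply/eqP; rewrite -subr_eq0; apply/negPn/negP => /dot_gt0.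
by rewrite {1}dotDl h -dotDl subrr linear0l ltxx.
Qed.

(** If E v = 0, then by [dot_basis] the sum of the squared moduli of the coordinates of [v] is zero,
    so the columns of [E] are independent. *)
Lemma orthonormal_basis_unit E : orthonormal_basis E -> E \in unitmx.
Proof.
move=> oE; rewrite -unitmx_tr -row_free_unit -kermx_eq0.
apply/eqP/row_matrixP => i; rewrite row0.
have : row i (kermx E^T) *m E^T = 0 by rewrite -row_mul mulmx_ker row0.
move: (row i _) => v /(congr1 trmx); rewrite trmx_mul trmxK trmx0 => Ev.
have := dot_basis v^T v^T oE; rewrite Ev linear0l mxE => /esym /eqP.
rewrite psumr_eq0 => [/allP h|j _]; last first.
  by rewrite !mxE -normCKC exprn_ge0.
apply/rowP => j; have := h j (mem_index_enum _).
by rewrite !mxE -normCKC expf_eq0 normr_eq0 => /eqP.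
Qed.

Lemma dot_basisV E x y : orthonormal_basis E ->
  ip x y = ((invmx E *m y)^H *m (invmx E *m x)) 0 0.
Proof.
move=> oE; have uE := orthonormal_basis_unit oE.
by rewrite -(dot_basis _ _ oE) !mulKVmx.
Qed.

Lemma trmxCM p q r (A : 'M[C]_(p, q)) (B : 'M[C]_(q, r)) :
  (A *m B)^H = B^H *m A^H.
Proof. by rewrite trmx_mul map_mxM. Qed.



Lemma orthonormal_basisM E U :
  orthonormal_basis E -> U^H *m U = 1%:M -> orthonormal_basis (E *m U).
Proof.
move=> oE /matrixP UU i j.
have colM k : col k (E *m U) = E *m col k U by rewrite !colE mulmxA.
rewrite !colM dot_basis // eq_sym; have := UU j i; rewrite !mxE => <-.
by apply: eq_bigr => k _; rewrite !mxE.
Qed.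

(** [adj] is selected by choice from its defining identity; nondegeneracy of [ip] leaves only one
    candidate. *)
Lemma adj_unique A B :
  (forall x y, ip (A *m x) y = ip x (B *m y)) -> adj ip A = B.
Proof.
move=> h; apply: xget_unique => //= B' h'; apply/matrixP => i j.
have : B' *m delta_mx j 0 = B *m delta_mx j 0 :> 'cV_n.
  by apply: dot_inj => z; rewrite dotC -h' h -dotC.
by rewrite -!colE => /colP /(_ i); rewrite !mxE.
Qed.

(** In an orthonormal basis the adjoint is the conjugate transpose of the matrix. This also provides
    the existence on which the choice in [adj] relies. *)
Lemma dot_basis_adj E A x y : orthonormal_basis E ->
  ip (A *m x) y = ip x (E *m (invmx E *m A *m E)^H *m invmx E *m y).
Proof.
move=> oE; have uE := orthonormal_basis_unit oE.
rewrite (dot_basisV (A *m x) y oE) (dot_basisV x _ oE); congr (_ 0 0).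
rewrite -!(mulmxA E) (mulKmx uE) -(mulmxA (_^H) _ y).
rewrite (trmxCM _ (invmx E *m y)) trmxCK.
by rewrite -(mulmxA _ _ (invmx E *m x)) -(mulmxA _ E) (mulKVmx uE) !mulmxA.
Qed.

Lemma adj_basis E A : orthonormal_basis E ->
  adj ip A = E *m (invmx E *m A *m E)^H *m invmx E.
Proof. by move=> oE; apply: adj_unique => x y; exact: dot_basis_adj. Qed.

(** A unitary matrix diagonalises the Gram matrix of the standard basis; the vectors it yields are
    orthogonal and only need rescaling. *)
Lemma exists_orthonormal_basis : exists E, orthonormal_basis E.
Proof.
pose G : 'M[C]_n := \matrix_(i, j) ip (delta_mx i 0) (delta_mx j 0).
have Gherm : G \is hermsymmx.
  apply/is_hermitianmxP; rewrite expr0 scale1r.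
  by apply/matrixP => i j; rewrite !mxE dotC.
have ipG (x y : 'cV[C]_n) : ip x y = (x^T *m G *m map_mx Num.conj y) 0 0.
  have dec (z : 'cV[C]_n) : z = \sum_i z i 0 *: delta_mx i 0.
    by rewrite [LHS]matrix_sum_delta; apply: eq_bigr => i _; rewrite big_ord1.
  rewrite {1}(dec x) {1}(dec y) dot_sumr mxE; apply: eq_bigr => j _.
  rewrite dotZr dot_suml !mxE mulrC; congr (_ * _); apply: eq_bigr => i _.
  by rewrite dotZl !mxE.
have /orthomx_spectralP GE := hermitian_normalmx Gherm.
set P := spectralmx G in GE; set d := spectral_diag G in GE.
have Pu : P \is unitarymx by apply: spectral_unitarymx.
have PPH : P *m P^H = 1%:M by apply/unitarymxP.
have PHP : P^H *m P = 1%:M by apply: mulmx1C.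
have invP : invmx P = P^H by rewrite invmx_unitary.
(* As [ip] is conjugate linear in the second argument, P G P^H is the Gram matrix of the transposed
   rows of [P]. *)
have dE i j : ip (col i P^T) (col j P^T) = d 0 i *+ (i == j).
  have -> : ip (col i P^T) (col j P^T) = (P *m G *m P^H) i j.
    rewrite ipG !mxE; apply: eq_bigr => k _; rewrite !mxE; congr (_ * _).
    by apply: eq_bigr => l _; rewrite !mxE.
  by rewrite GE invP !mulmxA PPH mul1mx -mulmxA PPH mulmx1 !mxE.
have d_gt0 i : 0 < d 0 i.
  have := dE i i; rewrite eqxx mulr1n => <-; apply: dot_gt0.
  apply/eqP => P0; have /matrixP /(_ i i) := PPH; rewrite !mxE eqxx big1.
    by move=> /eqP; rewrite eq_sym oner_eq0.
  by move=> k _; move/colP: P0 => /(_ k); rewrite !mxE => ->; rewrite mul0r.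
exists (\matrix_(k, i) ((sqrtC (d 0 i))^-1 * P i k)) => i j.
have colE' k : col k (\matrix_(k, i) ((sqrtC (d 0 i))^-1 * P i k)) =
   (sqrtC (d 0 k))^-1 *: col k P^T by apply/colP => l; rewrite !mxE.
rewrite !colE' dotZl dotZr dE; case: (eqVneq i j) => [<-|_]; last first.
  by rewrite mulr0n !mulr0.
have /CrealP -> : (sqrtC (d 0 i))^-1 \is Num.real.
  by rewrite rpredV ger0_real // sqrtC_ge0 ltW.
by rewrite mulr1n mulrA -invfM -expr2 sqrtCK mulVf // lt0r_neq0.
Qed.

Lemma onb_orthonormal : orthonormal_basis (onb ip).
Proof. exact: (xgetPex 0 exists_orthonormal_basis). Qed.

Lemma adjP A x y : ip (A *m x) y = ip x (adj ip A *m y).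
Proof.
have oE := onb_orthonormal.
pose B := onb ip *m (invmx (onb ip) *m A *m onb ip)^H *m invmx (onb ip).
apply: (xgetI 0 (P := [set B | forall X Y, ip (A *m X) Y = ip X (B *m Y)]%classic)
   (x := B)) => {}x {}y /=; exact: dot_basis_adj.
Qed.

Lemma adjPr A x y : ip x (A *m y) = ip (adj ip A *m x) y.
Proof. by rewrite dotC adjP -dotC. Qed.



Lemma adjD A B : adj ip (A + B) = adj ip A + adj ip B.
Proof.
by apply: adj_unique => x y; rewrite !mulmxDl dotDl dotDr !adjP.
Qed.

Lemma adjM A B : adj ip (A *m B) = adj ip B *m adj ip A.
Proof. by apply: adj_unique => x y; rewrite -!mulmxA !adjP. Qed.

Lemma adjZ (a : C) A : adj ip (a *: A) = Num.conj a *: adj ip A.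
Proof.
by apply: adj_unique => x y; rewrite -!scalemxAl dotZl dotZr adjP conjCK.
Qed.

(** The matrix of [A] in an orthonormal basis is Hermitian, so the spectral theorem for matrices
    applies and gives real eigenvalues. *)
Lemma eigenbasis_hermitian A : hermitian_op ip A ->
  exists E, orthonormal_basis E /\
  exists a : 'I_n -> R, forall i, A *m col i E = (a i)%:C *: col i E.
Proof.
move=> hA; have oE := onb_orthonormal.
set E0 := onb ip in oE; have uE := orthonormal_basis_unit oE.
pose A' := invmx E0 *m A *m E0.
have A'H : A'^H = A'.
  have /(congr1 (fun X => invmx E0 *m X *m E0)) := adj_basis A oE.
  by rewrite hA -!mulmxA mulVmx // mulmx1 mulKmx // !mulmxA => <-.
have Aherm : A' \is hermsymmx.
  by apply/is_hermitianmxP; rewrite expr0 scale1r.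
have /orthomx_spectralP AE := hermitian_normalmx Aherm.
have /mxOverP dR := hermitian_spectral_diag_real Aherm.
set P := spectralmx A' in AE; set d := spectral_diag A' in AE dR.
have Pu : P \is unitarymx by apply: spectral_unitarymx.
have PPH : P *m P^H = 1%:M by apply/unitarymxP.
have invP : invmx P = P^H by rewrite invmx_unitary.
(* Since A' = P^H diag(d) P, the eigenvectors of [A'] are the columns of P^H. *)
exists (E0 *m P^H); split.
  by apply: orthonormal_basisM => //; rewrite trmxCK.
exists (fun i => complex.Re (d 0 i)) => i.
rewrite RRe_real //; have -> : A = E0 *m A' *m invmx E0.
  by rewrite /A' !mulmxA mulmxV // mul1mx mulmxK.
rewrite AE invP !colE -!mulmxA mulKmx // [P *m _]mulmxA PPH mul1mx.
rewrite (scalemxAr (d 0 i) E0) (scalemxAr (d 0 i) P^H).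
congr (_ *m (_ *m _)).
apply/colP => k; rewrite mul_diag_mx !mxE.
by case: eqVneq => [->|_]; rewrite ?mulr0.
Qed.

Lemma orthonormal_basis_change E F : orthonormal_basis E ->
  orthonormal_basis F -> (invmx E *m F) *m (invmx E *m F)^H = 1%:M.
Proof.
move=> oE oF; apply: mulmx1C; apply/matrixP => i j.
have := oF j i; rewrite (dot_basisV _ _ oE) !mxE eq_sym => <-.
by apply: eq_bigr => k _; rewrite !colE !mulmxA -!colE !mxE.
Qed.

(** Expanding the vectors of [F] in [E] produces the coefficients of U U^H = 1. Values in an
    arbitrary module let the same statement serve scalar and operator sums. *)
Lemma orthonormal_sum_indep (V : lmodType C)
    (S : 'cV[C]_n -> 'cV[C]_n -> V) E F :
  (forall a x y z, S (a *: x + y) z = a *: S x z + S y z) ->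
  (forall a x y z, S z (a *: x + y) = Num.conj a *: S z x + S z y) ->
  orthonormal_basis E -> orthonormal_basis F ->
  \sum_i S (col i F) (col i F) = \sum_i S (col i E) (col i E).
Proof.
move=> Sl Sr oE oF; have uE := orthonormal_basis_unit oE.
have S0l z : S 0 z = 0.
  by have := Sl (-1) 0 0 z; rewrite !scaler0 addr0 scaleN1r addNr.
have S0r z : S z 0 = 0.
  have := Sr (-1) 0 0 z; rewrite !scaler0 addr0 => ->.
  by rewrite rmorphN1 scaleN1r addNr.
have Suml (a : 'I_n -> C) (u : 'I_n -> 'cV_n) z :
    S (\sum_i a i *: u i) z = \sum_i a i *: S (u i) z.
  apply: (big_ind2 (fun u v => S u z = v)) => // [v s w t <- <-|i _].
    by rewrite -{1}[v]scale1r Sl scale1r.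
  by rewrite -[a i *: u i]addr0 Sl S0l addr0.
have Sumr (a : 'I_n -> C) (u : 'I_n -> 'cV_n) z :
    S z (\sum_i a i *: u i) = \sum_i Num.conj (a i) *: S z (u i).
  apply: (big_ind2 (fun u v => S z u = v)) => // [v s w t <- <-|i _].
    by rewrite -{1}[v]scale1r Sr rmorph1 scale1r.
  by rewrite -[a i *: u i]addr0 Sr S0r addr0.
set U := invmx E *m F.
have UU := orthonormal_basis_change oE oF; rewrite -/U in UU.
have FE j : col j F = \sum_i U i j *: col i E.
  rewrite -[F](mulKVmx uE) -/U !colE -mulmxA mulmx_colE; apply: eq_bigr => i _.
  by rewrite -!colE !mxE.
transitivity (\sum_i \sum_k (U *m U^H) i k *: S (col i E) (col k E)).
  under eq_bigr => j _ do rewrite FE Suml.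
  rewrite exchange_big /=; apply: eq_bigr => i _.
  under eq_bigr => j _ do rewrite Sumr scaler_sumr.
  rewrite exchange_big /=; apply: eq_bigr => k _.
  rewrite mxE scaler_suml; apply: eq_bigr => j _.
  by rewrite !mxE scalerA.
rewrite UU; apply: eq_bigr => i _; rewrite (bigD1 i) //= big1 => [|k ki].
  by rewrite !mxE eqxx scale1r addr0.
by rewrite !mxE eq_sym (negPf ki) scale0r.
Qed.

End InnerProduct.

(** Meant for M along the line mu + t nu, which is quadratic in t: the result is the numerator of F
    on that line. *)
Lemma trace_square_quadratic (K : comNzRingType) n (X Y Z : 'M[K]_n) (t : K) :
  let Q := X + t *: Y + t ^+ 2 *: Z in
  \tr (Q *m Q) = \tr (X *m X) + t * (2 * \tr (X *m Y))
    + t ^+ 2 * (2 * \tr (X *m Z) + \tr (Y *m Y))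
    + t ^+ 3 * (2 * \tr (Y *m Z)) + t ^+ 4 * \tr (Z *m Z).
Proof.
rewrite /= !mulmxDl !mulmxDr -!scalemxAl -!scalemxAr !mxtraceD !mxtraceZ.
rewrite (mxtrace_mulC Y X) (mxtrace_mulC Z X) (mxtrace_mulC Z Y); ring.
Qed.

Section Operators.
Variables (C : fieldType) (n p q : nat).

Lemma Lop_mul (f : {bilinear 'cV[C]_n -> 'cV[C]_p -> 'cV[C]_q}) x y :
  Lop f x *m y = f x y.
Proof.
rewrite (mulmx_colE (Lop f x)) [in RHS](matrix_sum_delta y) linear_sumr.
apply: eq_bigr => i _; rewrite big_ord1 linearZr_LR; congr (_ *: _).
by apply/colP => k; rewrite !mxE.
Qed.

Lemma Rop_mul (f : {bilinear 'cV[C]_n -> 'cV[C]_p -> 'cV[C]_q}) x y :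
  Rop f y *m x = f x y.
Proof.
rewrite (mulmx_colE (Rop f y)) [in RHS](matrix_sum_delta x) linear_sumlz.
apply: eq_bigr => i _; rewrite big_ord1 linearZl_LR; congr (_ *: _).
by apply/colP => k; rewrite !mxE.
Qed.

Lemma LopP (f : {bilinear 'cV[C]_n -> 'cV[C]_p -> 'cV[C]_q}) a x y :
  Lop f (a *: x + y) = a *: Lop f x + Lop f y.
Proof. by apply/matrixP => i j; rewrite !mxE linearPl !mxE. Qed.

Lemma RopP (f : {bilinear 'cV[C]_n -> 'cV[C]_p -> 'cV[C]_q}) a x y :
  Rop f (a *: x + y) = a *: Rop f x + Rop f y.
Proof. by apply/matrixP => i j; rewrite !mxE linearPr !mxE. Qed.

End Operators.

(** * The moment matrix as a sesquilinear expression in structure constants *)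

Section MomentMatrix.
Variables (R : realType) (n : nat).
Local Notation C := R[i].
Implicit Types (c d : 'I_n -> 'I_n -> 'I_n -> C).

Definition innerc c d : C :=
  \sum_i \sum_j \sum_k c i j k * Num.conj (d i j k).

(* The polarization of M_mu, in structure constants with respect to an
   orthonormal basis. *)
Definition momentmx c d : 'M[C]_n := \matrix_(a, b)
  (2 * \sum_i \sum_j c i j a * Num.conj (d i j b)
   - 2 * \sum_i \sum_k c i b k * Num.conj (d i a k)
   - 2 * \sum_i \sum_k c b i k * Num.conj (d a i k)).

(** The parenthesis holds the coordinates of D.mu = D mu(.,.) - mu(D.,.) - mu(.,D.), so this is
    tr(Q(mu, nu) D) = 2 <D.mu, nu>, obtained by reordering sums. *)
Lemma tr_momentmxM c d (D : 'M[C]_n) :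
  \tr (momentmx c d *m D) = 2 * \sum_i \sum_j \sum_k
    (\sum_l D k l * c i j l - \sum_l c l j k * D l i - \sum_l c i l k * D l j)
    * Num.conj (d i j k).
Proof.
have -> : \tr (momentmx c d *m D) =
    2 * (\sum_a \sum_b \sum_i \sum_j D b a * c i j a * Num.conj (d i j b))
  - 2 * (\sum_a \sum_b \sum_i \sum_j c i b j * D b a * Num.conj (d i a j))
  - 2 * (\sum_a \sum_b \sum_i \sum_j c b i j * D b a * Num.conj (d a i j)).
  rewrite !mulr_sumr -!sumrB; apply: eq_bigr => a _.
  rewrite mxE !mulr_sumr -!sumrB; apply: eq_bigr => b _.
  rewrite mxE !mulrBl -!mulrA !mulr_suml; congr (2 * _ - 2 * _ - 2 * _);
  apply: eq_bigr => i _; rewrite mulr_suml; apply: eq_bigr => j _.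
  - by rewrite mulrC mulrA.
  - by rewrite mulrAC.
  - by rewrite mulrAC.
rewrite -!mulrBr; congr (2 * _).
have -> : \sum_a \sum_b \sum_i \sum_j D b a * c i j a * Num.conj (d i j b) =
  \sum_i \sum_j \sum_k (\sum_l D k l * c i j l) * Num.conj (d i j k).
  rewrite exchange_big /=.
  under eq_bigr => b _ do rewrite exchange_big /=.
  rewrite exchange_big /=; apply: eq_bigr => i _.
  under eq_bigr => b _ do rewrite exchange_big /=.
  rewrite exchange_big /=; apply: eq_bigr => j _; apply: eq_bigr => k _.
  by rewrite mulr_suml.
have -> : \sum_a \sum_b \sum_i \sum_j c i b j * D b a * Num.conj (d i a j) =
  \sum_i \sum_j \sum_k (\sum_l c i l k * D l j) * Num.conj (d i j k).
  under eq_bigr => b _ do rewrite exchange_big /=.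
  rewrite exchange_big /=; apply: eq_bigr => i _; apply: eq_bigr => j _.
  rewrite exchange_big /=; apply: eq_bigr => k _.
  by rewrite mulr_suml.
have -> : \sum_a \sum_b \sum_i \sum_j c b i j * D b a * Num.conj (d a i j) =
  \sum_i \sum_j \sum_k (\sum_l c l j k * D l i) * Num.conj (d i j k).
  apply: eq_bigr => i _; rewrite exchange_big /=; apply: eq_bigr => j _.
  rewrite exchange_big /=; apply: eq_bigr => k _.
  by rewrite mulr_suml.
rewrite -!sumrB; apply: eq_bigr => i _; rewrite -!sumrB.
apply: eq_bigr => j _; rewrite -!sumrB; apply: eq_bigr => k _.
by rewrite -!mulrBl; congr (_ * _); rewrite addrAC.
Qed.

(** The identity operator acts on bilinear maps as 1 - 1 - 1 = -1. *)
Lemma tr_momentmx c d : \tr (momentmx c d) = - 2 * innerc c d.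
Proof.
rewrite -[momentmx c d]mulmx1 tr_momentmxM mulNr -mulrN; congr (2 * _).
rewrite -sumrN; apply: eq_bigr => i _; rewrite -sumrN; apply: eq_bigr => j _.
rewrite -sumrN; apply: eq_bigr => k _; rewrite -mulNr; congr (_ * _).
have pick (f : 'I_n -> C) l : \sum_m f m * (1%:M : 'M[C]_n) m l = f l.
  rewrite (bigD1 l) //= big1 => [|m ml]; rewrite mxE ?eqxx ?mulr1 ?addr0 //.
  by rewrite (negPf ml) mulr0.
have -> : \sum_l (1%:M : 'M[C]_n) k l * c i j l = c i j k.
  rewrite -[RHS](pick (fun l => c i j l)); apply: eq_bigr => l _.
  by rewrite mulrC !mxE eq_sym.
rewrite (pick (fun l => c l j k)) (pick (fun l => c i l k)).
by rewrite subrr sub0r.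
Qed.

(** The hypothesis says D.mu = 0. The second argument [d] stays arbitrary, so that variations in
    every direction are covered. *)
Lemma tr_momentmx_derivation c d (D : 'M[C]_n) :
  (forall i j k, \sum_l D k l * c i j l =
     \sum_l c l j k * D l i + \sum_l c i l k * D l j) ->
  \tr (momentmx c d *m D) = 0.
Proof.
move=> h; rewrite tr_momentmxM big1 ?mulr0 // => i _; rewrite big1 // => j _.
by rewrite big1 // => k _; rewrite h -addrA -opprD subrr mul0r.
Qed.

Lemma momentmxH c d : (momentmx c d)^H = momentmx d c.
Proof.
apply/matrixP => a b; rewrite !mxE !rmorphB !rmorphM !rmorph_sum /=.
have -> : Num.conj (2 : C) = 2 by rewrite rmorph_nat.
by congr (2 * _ - 2 * _ - 2 * _); apply: eq_bigr => i _; rewrite rmorph_sum;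
  apply: eq_bigr => j _; rewrite rmorphM /= conjCK mulrC.
Qed.

Lemma innercC c d : Num.conj (innerc c d) = innerc d c.
Proof.
rewrite rmorph_sum; apply: eq_bigr => i _; rewrite rmorph_sum.
apply: eq_bigr => j _; rewrite rmorph_sum; apply: eq_bigr => k _.
by rewrite rmorphM /= conjCK mulrC.
Qed.

Lemma conj_trace (A : 'M[C]_n) : Num.conj (\tr A) = \tr A^H.
Proof. by rewrite rmorph_sum; apply: eq_bigr => i _; rewrite !mxE. Qed.

Lemma innerc_ge0 c : 0 <= innerc c c.
Proof. by do 3!(apply: sumr_ge0 => ? _); rewrite -normCK exprn_ge0. Qed.

Lemma innerc_eq0 c : innerc c c = 0 -> forall i j k, c i j k = 0.
Proof.
move=> h i j k; apply/eqP; rewrite -normr_eq0 -sqrf_eq0 normCK.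
have S3 i' j' : 0 <= \sum_k' c i' j' k' * Num.conj (c i' j' k').
  by apply: sumr_ge0 => ? _; rewrite -normCK exprn_ge0.
move/eqP: h; rewrite psumr_eq0 => [/allP/(_ i (mem_index_enum _))|i' _].
  rewrite psumr_eq0 => [/allP/(_ j (mem_index_enum _))|//].
  rewrite psumr_eq0 => [/allP/(_ k (mem_index_enum _))//|k' _].
  by rewrite -normCK exprn_ge0.
by apply: sumr_ge0.
Qed.

Let conj_perturb (u v : C) (t : R) :
  Num.conj (u + t%:C * v) = Num.conj u + t%:C * Num.conj v.
Proof. by rewrite rmorphD rmorphM /=; congr (_ + _ * _); exact: conjc_real. Qed.

(** Carries a quadratic expansion in [t] through one summation sign; nested sums apply it once per
    sign. *)
Let sum_perturb (I : finType) (P Q : I -> C) (S T : I -> C) (t : C) :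
  (forall i, P i = Q i + t * S i + t ^+ 2 * T i) ->
  \sum_i P i = \sum_i Q i + t * \sum_i S i + t ^+ 2 * \sum_i T i.
Proof.
by move=> h; rewrite !mulr_sumr -!big_split; apply: eq_bigr => i _; rewrite h.
Qed.

Lemma innerc_perturb c d (t : R) :
  innerc (fun i j k => c i j k + t%:C * d i j k)
         (fun i j k => c i j k + t%:C * d i j k) =
  innerc c c + t%:C * (innerc c d + innerc d c) + t%:C ^+ 2 * innerc d d.
Proof.
rewrite /innerc -big_split; apply: sum_perturb => i.
rewrite -big_split; apply: sum_perturb => j.
rewrite -big_split; apply: sum_perturb => k.
by rewrite conj_perturb /=; ring.
Qed.

Lemma momentmx_perturb c d (t : R) :
  momentmx (fun i j k => c i j k + t%:C * d i j k)
           (fun i j k => c i j k + t%:C * d i j k) =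
  momentmx c c + t%:C *: (momentmx c d + momentmx d c)
  + t%:C ^+ 2 *: momentmx d d.
Proof.
have sum2 (e e' : 'I_n -> 'I_n -> C) (g g' : 'I_n -> 'I_n -> C) :
  \sum_i \sum_j (e i j + t%:C * e' i j) * Num.conj (g i j + t%:C * g' i j) =
  \sum_i \sum_j e i j * Num.conj (g i j)
  + t%:C * (\sum_i \sum_j e i j * Num.conj (g' i j)
            + \sum_i \sum_j e' i j * Num.conj (g i j))
  + t%:C ^+ 2 * \sum_i \sum_j e' i j * Num.conj (g' i j).
  rewrite -big_split; apply: sum_perturb => i.
  rewrite -big_split; apply: sum_perturb => j.
  by rewrite conj_perturb /=; ring.
apply/matrixP => a b; rewrite !mxE.
rewrite (sum2 (fun i j => c i j a) (fun i j => d i j a)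
              (fun i j => c i j b) (fun i j => d i j b)).
rewrite (sum2 (fun i k => c i b k) (fun i k => d i b k)
              (fun i k => c i a k) (fun i k => d i a k)).
rewrite (sum2 (fun i k => c b i k) (fun i k => d b i k)
              (fun i k => c a i k) (fun i k => d a i k)).
ring.
Qed.

End MomentMatrix.

(** * From operators to structure constants in an arbitrary orthonormal basis *)

Section Moment.
Variables (R : realType) (n : nat).
Local Notation C := R[i].
Variable ip : {dot 'cV[C]_n for Num.conj}.
Implicit Types (E A B : 'M[C]_n) (x y : 'cV[C]_n).
Implicit Types (f : {bilinear 'cV[C]_n -> 'cV[C]_n -> 'cV[C]_n}).

Definition strconst E (mu : 'cV[C]_n -> 'cV[C]_n -> 'cV[C]_n) i j k : C :=
  ip (mu (col i E) (col j E)) (col k E).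

Lemma coord_basis E x k :
  orthonormal_basis ip E -> (invmx E *m x) k 0 = ip x (col k E).
Proof.
move=> oE; rewrite -[x in RHS](mulKVmx (orthonormal_basis_unit oE)) colE.
rewrite (dot_basis _ _ oE) [RHS]mxE (bigD1 k) //= big1 => [|j jk].
  by rewrite !mxE !eqxx rmorph1 mul1r addr0.
by rewrite !mxE (negPf jk) rmorph0 mul0r.
Qed.

Lemma entry_basis E A a b : orthonormal_basis ip E ->
  (invmx E *m A *m E) a b = ip (A *m col b E) (col a E).
Proof.
by move=> oE; rewrite -(coord_basis _ _ oE) (colE b E) !mulmxA -(colE b) [RHS]mxE.
Qed.

Lemma parseval E x y : orthonormal_basis ip E ->
  ip x y = \sum_k ip x (col k E) * Num.conj (ip y (col k E)).
Proof.
move=> oE; rewrite (dot_basisV _ _ oE) !mxE; apply: eq_bigr => k _.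
by rewrite 2!mxE !coord_basis // mulrC.
Qed.

Lemma strconst_inj E f : orthonormal_basis ip E ->
  (forall i j k, strconst E f i j k = 0) -> forall x y, f x y = 0.
Proof.
move=> oE c0 x y; have uE := orthonormal_basis_unit oE.
have f0 i j : f (col i E) (col j E) = 0.
  apply: (@dot_inj _ _ ip) => z; rewrite (parseval _ _ oE) big1.
    by rewrite linear0l.
  by move=> k _; rewrite [ip _ _]c0 mul0r.
rewrite -[x](mulKVmx uE) -[y](mulKVmx uE) !(mulmx_colE E).
rewrite linear_sumlz big1 // => i _; rewrite linearZl_LR linear_sumr big1.
  by rewrite scaler0.
by move=> j _; rewrite linearZr_LR f0 scaler0.
Qed.

(** Parseval eliminates the basis in the target; [orthonormal_sum_indep] then changes the basis in
    the two arguments of [f], one at a time. *)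
Lemma innerV_basis E f : orthonormal_basis ip E ->
  innerV ip f f = innerc (strconst E f) (strconst E f).
Proof.
move=> oE; have oB := onb_orthonormal ip.
have S1 x x' F : orthonormal_basis ip F ->
    \sum_j ip (f x (col j F)) (f x' (col j F)) =
    \sum_j ip (f x (col j E)) (f x' (col j E)).
  move=> oF.
  apply: (@orthonormal_sum_indep _ _ ip C^o (fun y z => ip (f x y) (f x' z)))
    => // a u v z.
    by rewrite linearPr dotDl dotZl.
  by rewrite linearPr dotDr dotZr.
have S2 : \sum_i \sum_j
      ip (f (col i (onb ip)) (col j E)) (f (col i (onb ip)) (col j E))
    = \sum_i \sum_j ip (f (col i E) (col j E)) (f (col i E) (col j E)).
  apply: (@orthonormal_sum_indep _ _ ip C^o
    (fun y z => \sum_j ip (f y (col j E)) (f z (col j E)))) => // a u v z.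
    transitivity (\sum_j (a * ip (f u (col j E)) (f z (col j E)) +
                          ip (f v (col j E)) (f z (col j E)))).
      by apply: eq_bigr => j _; rewrite linearPl dotDl dotZl.
    by rewrite big_split -mulr_sumr.
  transitivity (\sum_j (Num.conj a * ip (f z (col j E)) (f u (col j E)) +
                        ip (f z (col j E)) (f v (col j E)))).
    by apply: eq_bigr => j _; rewrite linearPl dotDr dotZr.
  by rewrite big_split -mulr_sumr.
transitivity (\sum_i \sum_j ip (f (col i E) (col j E)) (f (col i E) (col j E))).
  rewrite -S2; apply: eq_bigr => i _; rewrite -(S1 _ _ _ oB).
  by apply: eq_bigr => j _; rewrite (parseval _ _ oB).
by apply: eq_bigr => i _; apply: eq_bigr => j _; rewrite (parseval _ _ oE).
Qed.

Lemma normV2_basis E f : orthonormal_basis ip E ->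
  (normV2 ip f)%:C = innerc (strconst E f) (strconst E f).
Proof.
move=> oE; rewrite /normV2 (innerV_basis _ oE) RRe_real // ger0_real //.
exact: innerc_ge0.
Qed.

(** Each sum is the diagonal of an operator-valued sesquilinear map, conjugate linear through the
    adjoint. This frees M from the chosen basis [onb]. *)
Lemma Mop_sum E f : orthonormal_basis ip E -> Mop ip f =
  2 *: (\sum_i Lop f (col i E) *m adj ip (Lop f (col i E)))
  - 2 *: (\sum_i adj ip (Lop f (col i E)) *m Lop f (col i E))
  - 2 *: (\sum_i adj ip (Rop f (col i E)) *m Rop f (col i E)).
Proof.
move=> oE; have oB := onb_orthonormal ip.
have combine (X Y Z X' Y' Z' : 'M[C]_n) : X = X' -> Y = Y' -> Z = Z' ->
  2 *: X - 2 *: Y - 2 *: Z = 2 *: X' - 2 *: Y' - 2 *: Z' by move=> -> -> ->.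
rewrite /Mop; apply: combine.
- apply: (@orthonormal_sum_indep _ _ ip 'M[C]_n
    (fun x y => Lop f x *m adj ip (Lop f y))) => // a x y z.
    by rewrite LopP mulmxDl scalemxAl.
  by rewrite LopP adjD adjZ mulmxDr scalemxAr.
- apply: (@orthonormal_sum_indep _ _ ip 'M[C]_n
    (fun x y => adj ip (Lop f y) *m Lop f x)) => // a x y z.
    by rewrite LopP mulmxDr scalemxAr.
  by rewrite LopP adjD adjZ mulmxDl scalemxAl.
- apply: (@orthonormal_sum_indep _ _ ip 'M[C]_n
    (fun x y => adj ip (Rop f y) *m Rop f x)) => // a x y z.
    by rewrite RopP mulmxDr scalemxAr.
  by rewrite RopP adjD adjZ mulmxDl scalemxAl.
Qed.

Lemma Mop_basis E f : orthonormal_basis ip E ->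
  invmx E *m Mop ip f *m E = momentmx (strconst E f) (strconst E f).
Proof.
move=> oE; apply/matrixP => a b; rewrite entry_basis // (Mop_sum _ oE).
have split3 (X Y Z : 'M[C]_n) x y :
    ip ((2 *: X - 2 *: Y - 2 *: Z) *m x) y =
    2 * ip (X *m x) y - 2 * ip (Y *m x) y - 2 * ip (Z *m x) y.
  by rewrite !mulmxBl -!scalemxAl !dotBl !dotZl.
have combine (u v w u' v' w' : C) : u = u' -> v = v' -> w = w' ->
  2 * u - 2 * v - 2 * w = 2 * u' - 2 * v' - 2 * w' by move=> -> -> ->.
rewrite split3 mxE; apply: combine; rewrite mulmx_suml dot_suml;
  apply: eq_bigr => i _.
- rewrite -mulmxA adjP (parseval _ _ oE); apply: eq_bigr => j _.
  rewrite -!adjPr !Lop_mul (dotC _ (col b E)) (dotC _ (col a E)) conjCK.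
  by rewrite mulrC.
- rewrite -mulmxA -adjPr (parseval _ _ oE); apply: eq_bigr => j _.
  by rewrite !Lop_mul.
- rewrite -mulmxA -adjPr (parseval _ _ oE); apply: eq_bigr => j _.
  by rewrite !Rop_mul.
Qed.

End Moment.

(** * Derivatives of rational functions of one real variable *)

Section Rational.
Variable R : realType.
Implicit Types (p q : {poly R}) (x : R).

Lemma is_derive_rational p q x : q.[x] != 0 ->
  is_derive x (1 : R) (fun t => p.[t] / q.[t])
    ((p^`().[x] * q.[x] - p.[x] * q^`().[x]) / q.[x] ^+ 2).
Proof.
move=> qx0.
have dV : is_derive x (1 : R) (fun t => (q.[t])^-1)
    (- (q.[x]) ^- 2 *: q^`().[x]).
  apply: DeriveDef; first by apply: derivableV => //; exact: derivable_horner.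
  rewrite (@deriveV _ _ (horner q) x 1 qx0 (@derivable_horner _ q x)).
  by rewrite -derive1E -derivE.
apply: (is_derive_eq (is_deriveM (is_derive_poly p x) dV)).
by rewrite /GRing.scale /=; field.
Qed.

Lemma is_derive_fsum n (h : 'I_n -> R -> R) x (dh : 'I_n -> R) :
  (forall i, is_derive x (1 : R) (h i) (dh i)) ->
  is_derive x (1 : R) (fun t => \sum_i h i t) (\sum_i dh i).
Proof.
move/is_derive_sum; set s := (X in is_derive _ _ X _).
by have -> : s = fun t => \sum_i h i t by apply/funext => t; rewrite /s fct_sumE.
Qed.

(** Grouping the higher terms around the square of 'X leaves only squares to unfold when
    differentiating. *)
Definition quartic (a0 a1 a2 a3 a4 : R) : {poly R} :=
  a0%:P + a1%:P * 'X + (a2%:P + a3%:P * 'X + a4%:P * 'X ^+ 2) * 'X ^+ 2.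

Lemma horner_quartic a0 a1 a2 a3 a4 t : (quartic a0 a1 a2 a3 a4).[t] =
  a0 + t * a1 + t ^+ 2 * a2 + t ^+ 3 * a3 + t ^+ 4 * a4.
Proof. by rewrite /quartic !hornerE /=; ring. Qed.

Lemma horner0_quartic a0 a1 a2 a3 a4 : (quartic a0 a1 a2 a3 a4).[0] = a0.
Proof. by rewrite horner_quartic; ring. Qed.

Lemma deriv0_quartic a0 a1 a2 a3 a4 : (quartic a0 a1 a2 a3 a4)^`().[0] = a1.
Proof. by rewrite /quartic !expr2 !poly.derivE !hornerE /=; ring. Qed.

Lemma near_horner_neq0 p x : p.[x] != 0 -> \forall t \near x, p.[t] != 0.
Proof.
move=> px; have := @cvgr_neq0 _ _ _ (nbhs x) _ (horner p) p.[x].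
by apply => //; exact: continuous_horner.
Qed.

End Rational.

(** Lets [normV2_basis] apply to g.mu inside [rho]. *)
Lemma act_is_bilinear (C : fieldType) n (g : 'M[C]_n)
    (f : {bilinear 'cV[C]_n -> 'cV[C]_n -> 'cV[C]_n}) :
  bilinear_for *:%R *:%R (act g f).
Proof.
split=> u a x y; rewrite /act mulmxDr -scalemxAr.
  by rewrite linearPl mulmxDr -scalemxAr.
by rewrite linearPr mulmxDr -scalemxAr.
Qed.

HB.instance Definition _ (C : fieldType) n (g : 'M[C]_n)
    (f : {bilinear 'cV[C]_n -> 'cV[C]_n -> 'cV[C]_n}) :=
  bilinear_isBilinear.Build _ _ _ _ _ _ (act g f) (act_is_bilinear g f).

(** * The moment map is M divided by the squared norm *)

Section MomentMap.
Variables (R : realType) (n : nat).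
Local Notation C := R[i].
Variable ip : {dot 'cV[C]_n for Num.conj}.
Implicit Types (E A B : 'M[C]_n) (x y : 'cV[C]_n).
Implicit Types (f : {bilinear 'cV[C]_n -> 'cV[C]_n -> 'cV[C]_n}).

(** The two inverses of [g] on the arguments give the denominators, the outer [g] gives the
    numerator. *)
Lemma strconst_act_diag E f (g : 'M[C]_n) (b : 'I_n -> C) i j k :
  orthonormal_basis ip E -> (forall i, b i != 0) ->
  (forall i, g *m col i E = b i *: col i E) ->
  strconst ip E (act g f) i j k = b k / (b i * b j) * strconst ip E f i j k.
Proof.
move=> oE b0 gE; have uE := orthonormal_basis_unit oE.
have gE' : g *m E = E *m diag_mx (\row_i b i).
  apply/matrixP => r s; have /colP /(_ r) := gE s.
  rewrite mul_mx_diag !mxE mulrC => <-; apply: eq_bigr => l _.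
  by rewrite !mxE.
(* In the basis [E] the matrix [g] is diagonal with nonzero entries, so its determinant is
   nonzero. *)
have ug : g \in unitmx.
  rewrite unitmxE unitfE; have /(congr1 determinant) := gE'.
  rewrite !det_mulmx det_diag => detE; apply/eqP => g0.
  move: detE => /eqP; rewrite g0 mul0r eq_sym mulf_eq0.
  rewrite -[\det E == 0]negbK -unitfE -unitmxE uE /= prodf_seq_eq0.
  by case/hasP => l _; rewrite mxE (negPf (b0 l)).
have gV l : invmx g *m col l E = (b l)^-1 *: col l E.
  by rewrite -[RHS](mulKmx ug) -scalemxAr gE scalerA mulVf // scale1r.
have fZ u v (r s : C) : f (r *: u) (s *: v) = (r * s) *: f u v.
  by rewrite linearZl_LR linearZr_LR scalerA.
rewrite /strconst /act !gV fZ -scalemxAr dotZl.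
rewrite -invfM [b k / _]mulrC -mulrA; congr (_ * _).
rewrite -!(coord_basis _ _ oE); set v := f _ _.
have -> : invmx E *m (g *m v) = diag_mx (\row_i b i) *m (invmx E *m v).
  rewrite -[v in LHS](mulKVmx uE) (mulmxA g) gE' -(mulmxA E) mulKmx //.
by rewrite mul_diag_mx !mxE.
Qed.

(** Conjugate transposition swaps the two arguments of [momentmx], which coincide here. *)
Lemma Mop_hermitian f : hermitian_op ip (Mop ip f).
Proof.
have oE := onb_orthonormal ip; have uE := orthonormal_basis_unit oE.
rewrite /hermitian_op (adj_basis _ oE) (Mop_basis _ oE) momentmxH.
by rewrite -(Mop_basis _ oE) !mulmxA (mulmxV uE) mul1mx (mulmxK uE).
Qed.

Lemma adjN A : adj ip (- A) = - adj ip A.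
Proof. by rewrite -[- A]scaleN1r adjZ rmorphN1 scaleN1r. Qed.

Lemma trace_basis E A : orthonormal_basis ip E ->
  \tr A = \tr (invmx E *m A *m E).
Proof.
move=> oE; rewrite mxtrace_mulC mulmxA mulmxV ?mul1mx //.
exact: orthonormal_basis_unit.
Qed.

Lemma trace_basisM E A B : orthonormal_basis ip E ->
  \tr (A *m B) = \tr ((invmx E *m A *m E) *m (invmx E *m B *m E)).
Proof.
move=> oE; have uE := orthonormal_basis_unit oE.
by rewrite (trace_basis _ oE) !mulmxA (mulmxK uE).
Qed.

Lemma innerM_trace E A B : orthonormal_basis ip E ->
  innerM ip A B = \tr ((invmx E *m A *m E) *m (invmx E *m B *m E)^H).
Proof.
move=> oE; have uE := orthonormal_basis_unit oE.
by rewrite /innerM (adj_basis _ oE) (trace_basis _ oE) !mulmxA (mulmxKV uE).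
Qed.

Lemma innerM_conj A B : innerM ip A B = Num.conj (innerM ip B A).
Proof.
have oE := onb_orthonormal ip.
rewrite (innerM_trace A _ oE) (innerM_trace B _ oE) conj_trace.
by rewrite (trmxCM (_ *m B *m _)) trmxCK.
Qed.

Lemma innerM_linear a A B X :
  innerM ip (a *: A + B) X = a * innerM ip A X + innerM ip B X.
Proof.
rewrite /innerM; move: (adj ip X) => Y.
by rewrite mulmxDl -scalemxAl mxtraceD mxtraceZ.
Qed.

Lemma innerM_basis E A : orthonormal_basis ip E ->
  innerM ip A A = \sum_i \sum_j `|(invmx E *m A *m E) i j| ^+ 2.
Proof.
move=> oE; rewrite (innerM_trace A _ oE).
apply: eq_bigr => i _; rewrite mxE; apply: eq_bigr => j _.
by rewrite normCK !mxE.
Qed.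

Lemma innerM_ge0 A : 0 <= innerM ip A A.
Proof.
rewrite (innerM_basis _ (onb_orthonormal ip)).
by do 2!(apply: sumr_ge0 => ? _); rewrite exprn_ge0.
Qed.

Lemma innerM_eq0 A : innerM ip A A = 0 -> A = 0.
Proof.
have oE := onb_orthonormal ip; have uE := orthonormal_basis_unit oE.
rewrite (innerM_basis _ oE); set E := onb ip in oE uE *.
set A' := invmx E *m A *m E => /eqP.
have ge0 i : 0 <= \sum_j `|A' i j| ^+ 2.
  by apply: sumr_ge0 => j _; rewrite exprn_ge0.
rewrite psumr_eq0 // => /allP h.
have A'0 : A' = 0.
  apply/matrixP => i j; have := h i (mem_index_enum _).
  rewrite psumr_eq0 => [/allP /(_ j (mem_index_enum _))|k _].
    by rewrite [in RHS]mxE expf_eq0 normr_eq0 => /eqP.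
  by rewrite exprn_ge0.
have -> : A = E *m A' *m invmx E by rewrite !mulmxA mulmxV // mul1mx mulmxK.
by rewrite A'0 mulmx0 mul0mx.
Qed.

(* In an orthonormal eigenbasis of A, with eigenvalues a_i, the structure
   constants of (1 + tA).mu are those of mu multiplied by
   (1 + t a_k) / ((1 + t a_i) (1 + t a_j)): rho is a rational function of t. *)
Lemma drho_hermitian f A : hermitian_op ip A ->
  (drho ip f A)%:C = innerM ip (Mop ip f) A.
Proof.
move=> hA; have [E [oE [a aE]]] := eigenbasis_hermitian hA.
have uE := orthonormal_basis_unit oE.
pose cf := strconst ip E f.
pose N i j k := complex.Re (cf i j k * Num.conj (cf i j k)).
have NE i j k : (N i j k)%:C = cf i j k * Num.conj (cf i j k).
  by rewrite RRe_real // ger0_real // -normCK exprn_ge0.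
pose p k : {poly R} := (1 + (a k)%:P * 'X) ^+ 2.
pose q i j : {poly R} := ((1 + (a i)%:P * 'X) * (1 + (a j)%:P * 'X)) ^+ 2.
have q0 i j : (q i j).[0] = 1 by rewrite /q !hornerE !expr1n.
pose h : R -> R := fun t =>
  \sum_i \sum_j \sum_k N i j k * ((p k).[t] / (q i j).[t]).
(* The logarithmic derivative at 0 of the squared factor (1 + t a_k) / ((1 + t a_i)(1 + t a_j)) is 2
   (a_k - a_i - a_j), and its value there is 1. *)
have dh : is_derive (0 : R) (1 : R) h
   (\sum_i \sum_j \sum_k N i j k * (2 * (a k - a i - a j))).
  apply: is_derive_fsum => i; apply: is_derive_fsum => j.
  apply: is_derive_fsum => k; apply: is_deriveZ.
  apply: is_derive_eq; first by apply: is_derive_rational; rewrite q0 oner_neq0.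
  rewrite q0 expr1n divr1 /p /q !expr2 !poly.derivE.
  rewrite !hornerE /=; ring.
(* The formula is claimed only near 0, where all the factors 1 + t a_i are nonzero and 1 + tA is
   invertible; [P] gathers these factors into one polynomial. *)
have rhoE : \forall t \near (0 : R), h t = rho ip f (1%:M + t%:C *: A).
  pose P : {poly R} := \prod_i (1 + (a i)%:P * 'X).
  have P0 : P.[0] != 0.
    rewrite horner_prod; apply/prodf_neq0 => i _.
    by rewrite !hornerE oner_neq0.
  apply: filterS (near_horner_neq0 P0) => t.
  rewrite horner_prod => /prodf_neq0 Pt.
  pose b i := 1 + a i * t.
  have b0 i : b i != 0 by have := Pt i isT; rewrite !hornerE.
  apply: complexI; rewrite /rho (normV2_basis _ oE) /h.
  rewrite rmorph_sum /=; apply: eq_bigr => i _.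
  rewrite rmorph_sum /=; apply: eq_bigr => j _.
  rewrite rmorph_sum /=; apply: eq_bigr => k _.
  rewrite (@strconst_act_diag _ _ _ (fun i => (b i)%:C)) //.
- have bV : (b k)%:C / ((b i)%:C * (b j)%:C) = (b k / (b i * b j))%:C.
    by rewrite -rmorphM -fmorphV -rmorphM.
  have bJ : Num.conj (b k / (b i * b j))%:C = (b k / (b i * b j))%:C.
    exact: conjc_real.
  rewrite bV [X in _ = _ * X](rmorphM Num.conj) /= bJ mulrACA -NE -!rmorphM /=.
  rewrite -expr2 mulrC.
  by rewrite expr_div_n /p /q !hornerE.
- by move=> l; rewrite fmorph_eq0.
- move=> l; rewrite mulmxDl mul1mx -scalemxAl aE scalerA /b rmorphD rmorph1.
  by rewrite rmorphM mulrC scalerDl scale1r.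
have drhoE : drho ip f A = \sum_i \sum_j \sum_k N i j k * (2 * (a k - a i - a j)).
  by rewrite /drho derive1E; have [_ ->] := near_eq_is_derive rhoE dh.
rewrite drhoE /innerM hA (trace_basis _ oE).
have -> : invmx E *m (Mop ip f *m A) *m E =
    momentmx (strconst ip E f) (strconst ip E f) *m diag_mx (\row_i (a i)%:C).
  rewrite -(Mop_basis _ oE) -!mulmxA; congr (_ *m (_ *m _)).
  apply/matrixP => r s; rewrite mul_mx_diag !mxE mulrC.
  have /colP /(_ r) := aE s; rewrite !mxE => <-; apply: eq_bigr => l _.
  by rewrite !mxE.
rewrite tr_momentmxM mulr_sumr rmorph_sum /=; apply: eq_bigr => i _.
rewrite mulr_sumr rmorph_sum /=; apply: eq_bigr => j _.
rewrite mulr_sumr rmorph_sum /=; apply: eq_bigr => k _.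
rewrite (bigD1 k) //= big1 => [|l lk]; last by rewrite !mxE eq_sym (negPf lk) mul0r.
rewrite (bigD1 i) //= big1 => [|l lk]; last by rewrite !mxE (negPf lk) mulr0.
rewrite (bigD1 j) //= big1 => [|l lk]; last by rewrite !mxE (negPf lk) mulr0.
rewrite !mxE !eqxx !mulr1n !addr0 (rmorphM (real_complex R)) /= NE.
have -> : (2 * (a k - a i - a j))%:C = 2 * ((a k)%:C - (a i)%:C - (a j)%:C).
  by rewrite rmorphM !rmorphB rmorph_nat.
ring.
Qed.

Lemma hermitianD A B :
  hermitian_op ip A -> hermitian_op ip B -> hermitian_op ip (A + B).
Proof. by rewrite /hermitian_op adjD => -> ->. Qed.

Lemma hermitianZ (r : R) A : hermitian_op ip A -> hermitian_op ip (r%:C *: A).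
Proof.
rewrite /hermitian_op adjZ => ->; congr (_ *: _); exact: conjc_real.
Qed.

Lemma hermitianN A : hermitian_op ip A -> hermitian_op ip (- A).
Proof. by rewrite /hermitian_op adjN => ->. Qed.

(** The right-hand side satisfies the condition in [moment] by [drho_hermitian]; it remains to see
    that the condition determines the operator. *)
Lemma momentE f : moment ip f = ((normV2 ip f)^-1)%:C *: Mop ip f.
Proof.
have hM := hermitianZ (normV2 ip f)^-1 (Mop_hermitian f).
have MA A : hermitian_op ip A ->
    innerM ip (((normV2 ip f)^-1)%:C *: Mop ip f) A =
    (drho ip f A / normV2 ip f)%:C.
  move=> hA; rewrite /innerM -scalemxAl mxtraceZ mulrC rmorphM /=.
  by rewrite (drho_hermitian _ hA).
apply: xget_unique => // H [hH HA].
apply/eqP; rewrite -subr_eq0; apply/eqP; apply: innerM_eq0.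
(* The difference of two candidates is itself Hermitian, so it may be tested against itself. *)
have hK := hermitianD hH (hermitianN hM).
have BE X Y Z : innerM ip (X - Y) Z = innerM ip X Z - innerM ip Y Z.
  by rewrite /innerM mulmxBl linearB.
by rewrite BE HA // MA // subrr.
Qed.

Lemma FE E f : orthonormal_basis ip E ->
  let M := momentmx (strconst ip E f) (strconst ip E f) in
  F ip f = complex.Re (\tr (M *m M)) / normV2 ip f ^+ 2.
Proof.
move=> oE /=; have uE := orthonormal_basis_unit oE.
rewrite /F momentE /innerM (hermitianZ _ (Mop_hermitian f)).
rewrite -scalemxAl -scalemxAr !mxtraceZ mulrA -rmorphM.
rewrite (trace_basisM (Mop ip f) _ oE).
rewrite (Mop_basis _ oE).
by case: (\tr _) => r s /=; rewrite mul0r subr0 expr2 invfM mulrC.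
Qed.


Lemma strconst_derivation E f D i j k :
  orthonormal_basis ip E -> derivation f D ->
  let D' := invmx E *m D *m E in
  \sum_l D' k l * strconst ip E f i j l =
  \sum_l strconst ip E f l j k * D' l i + \sum_l strconst ip E f i l k * D' l j.
Proof.
move=> oE dD /=; set D' := _ *m D *m _; have uE := orthonormal_basis_unit oE.
have DE r : D *m col r E = \sum_l D' l r *: col l E.
  have ED : D *m E = E *m D' by rewrite /D' !mulmxA (mulmxV uE) mul1mx.
  rewrite colE mulmxA ED -mulmxA -colE mulmx_colE.
  by apply: eq_bigr => l _; rewrite mxE.
transitivity (ip (D *m f (col i E) (col j E)) (col k E)).
  rewrite -(coord_basis _ _ oE); set v := f _ _.
  have -> : invmx E *m (D *m v) = D' *m (invmx E *m v).
    by rewrite /D' -!mulmxA (mulKVmx uE).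
  by rewrite [RHS]mxE; apply: eq_bigr => l _; rewrite (coord_basis _ _ oE).
rewrite dD dotDl !DE linear_sumlz linear_sumr !dot_suml.
congr (_ + _); apply: eq_bigr => l _.
  by rewrite linearZl_LR dotZl mulrC.
by rewrite linearZr_LR dotZl mulrC.
Qed.

Lemma normV2_gt0 f : (exists x y, f x y != 0) -> 0 < normV2 ip f.
Proof.
move=> [x [y fxy]]; have oE := onb_orthonormal ip.
rewrite -ltcR (normV2_basis _ oE) lt_neqAle innerc_ge0 andbT eq_sym.
apply/eqP => /innerc_eq0 c0; move/eqP: fxy; apply.
exact: (strconst_inj oE c0).
Qed.



(** The line used in [critical], named so that it can carry a bilinear structure. *)
Definition perturb f (nu : 'cV[C]_n -> 'cV[C]_n -> 'cV[C]_n) (t : R) :=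
  fun X Y => f X Y + t%:C *: nu X Y.

Lemma perturb_is_bilinear f (nu : {bilinear 'cV[C]_n -> 'cV[C]_n -> 'cV[C]_n}) t :
  bilinear_for *:%R *:%R (perturb f nu t).
Proof.
split=> u a x y; rewrite /perturb.
  by rewrite !linearPl; apply/colP => k; rewrite !mxE; ring.
by rewrite !linearPr; apply/colP => k; rewrite !mxE; ring.
Qed.

HB.instance Definition _ f (nu : {bilinear 'cV[C]_n -> 'cV[C]_n -> 'cV[C]_n}) t :=
  bilinear_isBilinear.Build _ _ _ _ _ _ (perturb f nu t)
    (perturb_is_bilinear f nu t).

(** * Consequences of M = cI + D with D a derivation: the sign of c, and criticality *)

Section Decomposition.
Variables (f : {bilinear 'cV[C]_n -> 'cV[C]_n -> 'cV[C]_n}).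
Variables (c : R) (D : 'M[C]_n).
Hypotheses (f0 : exists x y, f x y != 0) (fcD : Mop_decomp ip f c D).

Let E := onb ip.
Let oE : orthonormal_basis ip E := onb_orthonormal ip.
Let D' := invmx E *m D *m E.
Let cf := strconst ip E f.
Let N := normV2 ip f.

Let momentmx_decomp : momentmx cf cf = (c%:C)%:M + D'.
Proof.
case: fcD => _ McD; have uE := orthonormal_basis_unit oE.
rewrite -(Mop_basis _ oE) McD mulmxDr mulmxDl; congr (_ + _).
by rewrite mul_mx_scalar -scalemxAl (mulVmx uE) scalemx1.
Qed.

Let tr_moment_D d : \tr (momentmx cf d *m D') = 0.
Proof.
apply: tr_momentmx_derivation => i j k; apply: strconst_derivation => //.
by case: fcD.
Qed.

Let D'_herm : D'^H = D'.
Proof.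
have -> : D' = momentmx cf cf - (c%:C)%:M by rewrite momentmx_decomp addrC addKr.
rewrite linearB /= map_mxB momentmxH tr_scalar_mx map_scalar_mx.
by congr (_ - _%:M); exact: conjc_real.
Qed.

(** The conjugate of [tr_moment_D], because [D'] is Hermitian. *)
Let tr_D_moment d : \tr (momentmx d cf *m D') = 0.
Proof.
have := congr1 Num.conj (tr_moment_D d); rewrite rmorph0 => <-.
by rewrite conj_trace (trmxCM (momentmx cf d)) momentmxH D'_herm mxtrace_mulC.
Qed.

Let N_E : N%:C = innerc cf cf. Proof. exact: normV2_basis. Qed.

(** Write one factor as cI + D: the derivation contributes nothing, and the trace of M is -2 [N]. *)
Lemma trace_Mop2 : \tr (Mop ip f *m Mop ip f) = (- 2 * c * N)%:C.
Proof.
rewrite (trace_basisM _ _ oE) (Mop_basis _ oE) -/cf {2}momentmx_decomp.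
rewrite mulmxDr mxtraceD tr_moment_D addr0 mul_mx_scalar.
rewrite mxtraceZ tr_momentmx -N_E !rmorphM rmorphN rmorph_nat; ring.
Qed.

(** As M is Hermitian, -2cN is its squared norm, which excludes c > 0. If c = 0 then M = 0, against
    tr M = -2 [N] with [N] positive. *)
Lemma decomp_lt0 : c < 0.
Proof.
have N0 : 0 < N by apply: normV2_gt0.
have uE := orthonormal_basis_unit oE.
have MM : innerM ip (Mop ip f) (Mop ip f) = (- 2 * c * N)%:C.
  by rewrite /innerM Mop_hermitian trace_Mop2.
have ge0 : 0 <= innerM ip (Mop ip f) (Mop ip f) by apply: innerM_ge0.
rewrite ltNge le_eqVlt; apply/negP => /orP[/eqP c0|c_gt0].
  move: MM; rewrite -c0 mulr0 mul0r => /innerM_eq0 M0.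
  have := tr_momentmx cf cf; rewrite -(Mop_basis _ oE) M0 mulmx0 mul0mx.
  rewrite mxtrace0 -N_E => /esym/eqP; rewrite mulf_eq0 oppr_eq0 pnatr_eq0 /=.
  by rewrite fmorph_eq0 gt_eqF.
move: ge0; rewrite MM ler0c mulNr mulNr oppr_ge0 leNgt.
by rewrite !mulr_gt0.
Qed.

Lemma decomp_critical : critical ip f.
Proof.
split=> // nu.
pose d := strconst ip E nu.
pose Mt t := momentmx (fun i j k => cf i j k + t%:C * d i j k)
                      (fun i j k => cf i j k + t%:C * d i j k).
pose M0 := momentmx cf cf.
pose M1 := momentmx cf d + momentmx d cf.
pose M2 := momentmx d d.
pose r (z : C) := complex.Re z.
pose p := quartic (r (\tr (M0 *m M0))) (2 * r (\tr (M0 *m M1)))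
  (2 * r (\tr (M0 *m M2)) + r (\tr (M1 *m M1))) (2 * r (\tr (M1 *m M2)))
  (r (\tr (M2 *m M2))).
pose n1 := r (innerc cf d + innerc d cf).
pose q : {poly R} := (N%:P + n1%:P * 'X + (r (innerc d d))%:P * 'X ^+ 2) ^+ 2.
have N0 : 0 < N by apply: normV2_gt0.
(* The sum is its own conjugate, so taking the real part loses nothing; [n1] is the derivative of
   the squared norm along [nu]. *)
have n1E : n1%:C = innerc cf d + innerc d cf.
  rewrite RRe_real //; apply/CrealP.
  by rewrite rmorphD /= !innercC addrC.
have realc (z : C) t : complex.Re (t%:C * z) = t * complex.Re z.
  by case: z => u v /=; rewrite mul0r subr0.
have m2 : (- 2 : C) = (- 2 : R)%:C by rewrite rmorphN rmorph_nat.
(* This holds for all t: where the norm vanishes, both sides are 0 because the inverse of 0 is 0. *)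
have FE' : (fun t : R => F ip (fun X Y => f X Y + t%:C *: nu X Y)) =
    (fun t => p.[t] / q.[t]).
  apply/funext => t; rewrite [LHS](FE (perturb f nu t) oE).
  have scE : strconst ip E (perturb f nu t) =
      fun i j k => cf i j k + t%:C * d i j k.
    apply/funext => i; apply/funext => j; apply/funext => k.
    by rewrite /strconst /perturb dotDl dotZl.
  have normE : normV2 ip (perturb f nu t) =
      N + n1 * t + r (innerc d d) * t ^+ 2.
    apply: complexI; rewrite (normV2_basis _ oE) scE innerc_perturb.
    have ddE : (r (innerc d d))%:C = innerc d d.
      by rewrite RRe_real // ger0_real // innerc_ge0.
    rewrite expr2 !(rmorphD (real_complex R)) !(rmorphM (real_complex R)) /=.
    by rewrite n1E N_E ddE; ring.
  have trE : complex.Re (\tr (Mt t *m Mt t)) = p.[t].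
    have -> : \tr (Mt t *m Mt t) = \tr (M0 *m M0) + t%:C * (2 * \tr (M0 *m M1))
      + t%:C ^+ 2 * (2 * \tr (M0 *m M2) + \tr (M1 *m M1))
      + t%:C ^+ 3 * (2 * \tr (M1 *m M2)) + t%:C ^+ 4 * \tr (M2 *m M2).
      by rewrite /Mt momentmx_perturb; exact: trace_square_quadratic.
    have realcX (z : C) k : complex.Re (t%:C ^+ k * z) = t ^+ k * complex.Re z.
      by rewrite -rmorphXn realc.
    have two (z : C) : complex.Re (2 * z) = 2 * complex.Re z.
      by rewrite -realc rmorph_nat.
    have ReD (u v : C) : complex.Re (u + v) = complex.Re u + complex.Re v.
      by case: u; case: v.
    by rewrite !(ReD, realcX, realc, two) /p horner_quartic.
  by rewrite -/E scE -/(Mt t) trE normE /q !hornerE.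
have q0 : q.[0] = N ^+ 2 by rewrite /q !hornerE /=; ring.

have trM X : \tr (M0 *m X) = c%:C * \tr X + \tr (D' *m X).
  by rewrite /M0 momentmx_decomp mulmxDl mul_scalar_mx mxtraceD mxtraceZ.
have p0 : p.[0] = - 2 * c * N.
  rewrite /p horner0_quartic trM mxtrace_mulC tr_moment_D addr0.
  by rewrite tr_momentmx -N_E /r realc m2 realc /=; ring.
(* With [M0] = cI + [D'], the terms containing [D'] vanish by [tr_moment_D] and [tr_D_moment],
   leaving c times the trace of [M1]. *)
have p1 : p^`().[0] = 2 * (- 2 * c * n1).
  rewrite /p deriv0_quartic trM (mxtrace_mulC D') {2}/M1 mulmxDl mxtraceD.
  rewrite tr_moment_D tr_D_moment.
  rewrite !addr0 mxtraceD !tr_momentmx -mulrDr -n1E /r realc.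
  by rewrite m2 realc /=; ring.
have q1 : q^`().[0] = 2 * N * n1.
  rewrite /q !expr2 !poly.derivE !hornerE /=; ring.
rewrite FE'; apply: is_derive_eq.
  by apply: is_derive_rational; rewrite q0 expf_neq0 // gt_eqF.
(* The numerator of the quotient rule is -4 c n1 N^2 + 4 c n1 N^2 = 0. *)
rewrite q0 p0 p1 q1.
have N00 : N != 0 by rewrite gt_eqF.
by field.
Qed.

End Decomposition.
End MomentMap.

(** Conjugate linearity in the second argument follows from linearity in the first and Hermitian
    symmetry. *)
Lemma exists_dot (R : realType) n (g : 'cV[R[i]]_n -> 'cV[R[i]]_n -> R[i]) :
  (forall a x y z, g (a *: x + y) z = a * g x z + g y z) ->
  (forall x y, g x y = Num.conj (g y x)) ->
  (forall x, x != 0 -> 0 < g x x) ->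
  exists ip : {dot 'cV[R[i]]_n for Num.conj}, forall x y, ip x y = g x y.
Proof.
move=> gl gC g0.
have gb : bilinear_for *%R (Num.conj \; *%R) g.
  split=> [z|z] a x y /=; first exact: gl.
  by rewrite gC gl rmorphD rmorphM /= -!gC.
have gh x y : g x y = (-1) ^+ false * Num.conj (g y x) by rewrite mul1r.
pose ip : {dot 'cV[R[i]]_n for Num.conj} := HB.pack g
  (bilinear_isBilinear.Build _ _ _ _ _ _ g gb)
  (isHermitianSesquilinear.Build _ _ _ _ g gh) (isDotProduct.Build _ _ g g0).
by exists ip.
Qed.

Lemma col_block_lshift (K : fieldType) n p (A : 'M[K]_n) (B : 'M[K]_p) i :
  col (lshift p i) (block_mx A 0 0 B) = col_mx (col i A) 0.
Proof.
apply/colP => k; rewrite mxE; case: (split_ordP k) => j ->.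
  by rewrite block_mxEul col_mxEu mxE.
by rewrite block_mxEdl col_mxEd !mxE.
Qed.

Lemma col_block_rshift (K : fieldType) n p (A : 'M[K]_n) (B : 'M[K]_p) i :
  col (rshift n i) (block_mx A 0 0 B) = col_mx 0 (col i B).
Proof.
apply/colP => k; rewrite mxE; case: (split_ordP k) => j ->.
  by rewrite block_mxEur col_mxEu !mxE.
by rewrite block_mxEdr col_mxEd mxE.
Qed.

(** * Blocks of the moment matrix for structure constants of a semidirect sum *)

Section MomentBlock.
Variables (R : realType) (p m : nat).
Local Notation C := R[i].
Variables (c : 'I_(p + m) -> 'I_(p + m) -> 'I_(p + m) -> C).
Variables (L Q : 'I_p -> 'I_m -> 'I_m -> C) (s : 'I_m -> 'I_m -> 'I_m -> C).
Hypotheses (c_ll : forall i j k, c (lshift m i) (lshift m j) k = 0).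
Hypotheses (c_l : forall i j k, c i j (lshift m k) = 0).
Hypotheses (c_lr : forall i j k, c (lshift m i) (rshift p j) (rshift p k) = L i j k).
Hypotheses (c_rl : forall i j k, c (rshift p j) (lshift m i) (rshift p k) = Q i j k).
Hypotheses (c_rr : forall i j k, c (rshift p i) (rshift p j) (rshift p k) = s i j k).

Let sum0 (I : finType) (P : I -> C) : (forall i, P i = 0) -> \sum_i P i = 0.
Proof. by move=> h; rewrite big1. Qed.

(** Products have no component in the abelian summand, which kills the positive term; the others
    give the trace forms of the left and right actions. *)
Lemma momentmx_block_ul a b : momentmx c c (lshift m a) (lshift m b) =
  - 2 * (\sum_j \sum_k L b j k * Num.conj (L a j k) +
         \sum_j \sum_k Q b j k * Num.conj (Q a j k)).
Proof.
rewrite mxE sum0 => [|i]; last by rewrite sum0 // => j; rewrite c_l mul0r.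
rewrite !big_split_ord /= sum0 => [|i]; last first.
  by rewrite sum0 // => j; rewrite c_ll mul0r.
rewrite [X in _ - _ - 2 * (X + _)]sum0 => [|i]; last first.
  by rewrite sum0 // => j; rewrite c_ll mul0r.
rewrite mulr0 !add0r mulNr mulrDr opprD [RHS]addrC; congr (- (2 * _) - 2 * _);
apply: eq_bigr => i _; rewrite big_split_ord /= sum0 ?add0r => [|k].
- by apply: eq_bigr => k _; rewrite !c_rl.
- by rewrite c_l mul0r.
- by apply: eq_bigr => k _; rewrite !c_lr.
- by rewrite c_l mul0r.
Qed.

(** What survives pairs the right and left multiplications of lambda with the operators of the
    representation. *)
Lemma momentmx_block_ur a b : momentmx c c (lshift m a) (rshift p b) =
  - 2 * (\sum_j \sum_k s j b k * Num.conj (Q a j k) +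
         \sum_j \sum_k s b j k * Num.conj (L a j k)).
Proof.
rewrite mxE sum0 => [|i]; last by rewrite sum0 // => j; rewrite c_l mul0r.
rewrite !big_split_ord /= sum0 => [|i]; last first.
  by rewrite sum0 // => j; rewrite c_ll rmorph0 mulr0.
rewrite [X in _ - _ - 2 * (X + _)]sum0 => [|i]; last first.
  by rewrite sum0 // => j; rewrite c_ll rmorph0 mulr0.
rewrite mulr0 !add0r mulNr mulrDr opprD; congr (- (2 * _) - 2 * _);
apply: eq_bigr => i _; rewrite big_split_ord /= sum0 ?add0r => [|k].
- by apply: eq_bigr => k _; rewrite !c_rl c_rr.
- by rewrite c_l mul0r.
- by apply: eq_bigr => k _; rewrite !c_lr c_rr.
- by rewrite c_l mul0r.
Qed.

(** The two hypotheses are normality of the actions, in coordinates: the products of an operator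
    with its adjoint in the two orders enter with opposite signs and cancel. *)
Lemma momentmx_block_dr a b :
  (forall i a b, \sum_j L i j a * Num.conj (L i j b) =
                 \sum_k L i b k * Num.conj (L i a k)) ->
  (forall i a b, \sum_j Q i j a * Num.conj (Q i j b) =
                 \sum_k Q i b k * Num.conj (Q i a k)) ->
  momentmx c c (rshift p a) (rshift p b) = momentmx s s a b.
Proof.
move=> nL nQ; rewrite !mxE !big_split_ord /=.
(* Here [x] comes from the left action, cancelled by the second sum, and [y] from the right action,
   cancelled by the third. *)
have split3 (u v w x y u' v' w' : C) : u = x + (y + u') -> v = x + v' ->
    w = y + w' -> 2 * u - 2 * v - 2 * w = 2 * u' - 2 * v' - 2 * w'.
  by move=> -> -> ->; ring.
apply: (split3 _ _ _ (\sum_i \sum_j L i j a * Num.conj (L i j b))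
                     (\sum_i \sum_j Q i j a * Num.conj (Q i j b))).
- congr (_ + _).
    apply: eq_bigr => i _; rewrite big_split_ord /= sum0 ?add0r => [|j].
      by apply: eq_bigr => j _; rewrite !c_lr.
    by rewrite c_ll mul0r.
  rewrite [X in _ = X + _]exchange_big -big_split; apply: eq_bigr => j _.
  rewrite big_split_ord /=; congr (_ + _).
    by apply: eq_bigr => i _; rewrite !c_rl.
  by apply: eq_bigr => i _; rewrite !c_rr.
- congr (_ + _); apply: eq_bigr => i _; rewrite big_split_ord /= sum0 ?add0r => [|k].
  + by rewrite nL; apply: eq_bigr => k _; rewrite !c_lr.
  + by rewrite c_l mul0r.
  + by apply: eq_bigr => k _; rewrite !c_rr.
  + by rewrite c_l mul0r.
- congr (_ + _); apply: eq_bigr => i _; rewrite big_split_ord /= sum0 ?add0r => [|k].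
  + by rewrite nQ; apply: eq_bigr => k _; rewrite !c_rl.
  + by rewrite c_l mul0r.
  + by apply: eq_bigr => k _; rewrite !c_rr.
  + by rewrite c_l mul0r.
Qed.

End MomentBlock.

(** * The extended inner product and M of the extension *)

Section Extension.
Variables (R : realType) (p m : nat).
Local Notation C := R[i].
Variable ip : {dot 'cV[C]_m for Num.conj}.
Variable lambda : {bilinear 'cV[C]_m -> 'cV[C]_m -> 'cV[C]_m}.
Variables (c : R) (D : 'M[C]_m).
Hypotheses (lambda0 : exists x y, lambda x y != 0).
Hypotheses (lambda_cD : Mop_decomp ip lambda c D).
Variable Lr : {bilinear 'cV[C]_p -> 'cV[C]_m -> 'cV[C]_m}.
Variable Rr : {bilinear 'cV[C]_m -> 'cV[C]_p -> 'cV[C]_m}.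
Variable mu : {bilinear 'cV[C]_(p + m) -> 'cV[C]_(p + m) -> 'cV[C]_(p + m)}.
Hypothesis muE : forall (A B : 'cV[C]_p) (X Y : 'cV[C]_m),
  mu (col_mx A X) (col_mx B Y) = col_mx 0 (Lr A Y + Rr X B + lambda X Y).
Hypothesis D_comm : forall A, comm_mx D (Lop Lr A) /\ comm_mx D (Rop Rr A).
Hypothesis normalLR : forall A, comm_mx (Lop Lr A) (adj ip (Lop Lr A)) /\
  comm_mx (Rop Rr A) (adj ip (Rop Rr A)).
Hypothesis faithful : forall A, A != 0 -> Lop Lr A != 0 \/ Rop Rr A != 0.

Let c_lt0 : c < 0. Proof. exact: decomp_lt0 lambda_cD. Qed.

Lemma decomp_hermitian : hermitian_op ip D.
Proof.
case: lambda_cD => _ Mc; have -> : D = Mop ip lambda - c%:C *: 1%:M.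
  by rewrite Mc scalemx1 addrC addKr.
apply: hermitianD; first exact: Mop_hermitian.
apply: hermitianN; apply: hermitianZ; apply: adj_unique => x y.
by rewrite !mul1mx.
Qed.

Let g A B : C := - (2 / c)%:C *
  (innerM ip (Lop Lr A) (Lop Lr B) + innerM ip (Rop Rr A) (Rop Rr B)).

(** The factor -2/c is positive because c < 0, and [faithful] makes the form definite. *)
Lemma exists_dot_abelian : exists ipa : {dot 'cV[C]_p for Num.conj},
  forall A B, ipa A B = g A B.
Proof.
apply: exists_dot => [a x y z|x y|x x0].
- rewrite /g LopP RopP !innerM_linear.
  by do 4!(move: (innerM _ _ _) => ?); ring.
- have conj_comb (k : R) (u v u' v' : C) : u' = Num.conj u -> v' = Num.conj v ->
      - k%:C * (u' + v') = Num.conj (- k%:C * (u + v)).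
    move=> -> ->; rewrite rmorphM rmorphD rmorphN /=; congr (- _ * _).
    by apply/esym; exact: conjc_real.
  by apply: conj_comb; exact: innerM_conj.
- have k0 : 0 < - (2 / c)%:C.
    by rewrite -rmorphN ltcR oppr_gt0 pmulr_rlt0 // invr_lt0.
  rewrite /g mulr_gt0 //.
  have pos (A : 'M[C]_m) : A != 0 -> 0 < innerM ip A A.
    move=> A0; rewrite lt_neqAle innerM_ge0 andbT eq_sym.
    by apply: contra A0 => /eqP /innerM_eq0 ->.
  by case: (faithful x0) => /pos h; [apply: ltr_pwDl|apply: ltr_wpDl];
    rewrite ?innerM_ge0.
Qed.

Lemma exists_dot_extension : exists ipn : {dot 'cV[C]_(p + m) for Num.conj},
  forall A B X Y, ipn (col_mx A X) (col_mx B Y) = g A B + ip X Y.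
Proof.
have [ipa ipaE] := exists_dot_abelian.
have [ipn ipnE] : exists ipn : {dot 'cV[C]_(p + m) for Num.conj},
    forall x y, ipn x y = ipa (usubmx x) (usubmx y) + ip (dsubmx x) (dsubmx y).
  apply: exists_dot => [a x y z|x y|x x0].
  - by rewrite !linearP /= !linearPl /=; ring.
  - by rewrite rmorphD /= -!dotC.
  - have dot_ge0 n (q : {dot 'cV[C]_n for Num.conj}) v : 0 <= q v v.
      by have [->|/(dot_gt0 q)/ltW//] := eqVneq v 0; rewrite linear0l.
    have [u0|/(dot_gt0 ipa) u0] := eqVneq (usubmx x) 0; last first.
      by apply: ltr_pwDl => //; apply: dot_ge0.
    apply: ltr_wpDl; first exact: dot_ge0.
    apply: dot_gt0; apply: contra x0 => /eqP d0.
    by rewrite -[x]vsubmxK u0 d0 col_mx0.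
by exists ipn => A B X Y; rewrite ipnE !col_mxKu !col_mxKd ipaE.
Qed.

Lemma comm_adj S : comm_mx D S -> comm_mx D (adj ip S).
Proof.
move=> DS; have := congr1 (adj ip) DS; rewrite !adjM decomp_hermitian.
by rewrite /comm_mx => ->.
Qed.

(** Since D is Hermitian, it commutes with the adjoint of [S] too, and cyclicity of the trace makes
    the two terms equal. *)
Lemma innerM_bracket X S : comm_mx D S -> innerM ip (D *m X - X *m D) S = 0.
Proof.
move=> /comm_adj DS; rewrite /innerM mulmxBl linearB /=.
by rewrite -(mulmxA X) DS mulmxA -[D *m X *m _]mulmxA mxtrace_mulC subrr.
Qed.

(* D acts on L_X by a commutator, so L_X is an eigenvector of ad D with
   eigenvalue a <> 0, orthogonal to the operators commuting with D. *)
Lemma innerM_Lop_eigen a X A : a != 0 -> D *m X = a *: X ->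
  innerM ip (Lop lambda X) (Lop Lr A) = 0.
Proof.
move=> a0 DX; have [DL _] := D_comm A; case: lambda_cD => dD _.
have LD : a *: Lop lambda X = D *m Lop lambda X - Lop lambda X *m D.
  apply: mulmx_ext => y; rewrite mulmxBl -!mulmxA -scalemxAl !Lop_mul dD DX.
  by rewrite linearZl_LR addrK.
have := innerM_bracket (Lop lambda X) DL.
rewrite -LD -[a *: _]addr0 innerM_linear => /eqP.
by rewrite {2}/innerM mul0mx mxtrace0 addr0 mulf_eq0 (negPf a0) => /eqP.
Qed.

Lemma innerM_Rop_eigen a X A : a != 0 -> D *m X = a *: X ->
  innerM ip (Rop lambda X) (Rop Rr A) = 0.
Proof.
move=> a0 DX; have [_ DR] := D_comm A; case: lambda_cD => dD _.
have RD : a *: Rop lambda X = D *m Rop lambda X - Rop lambda X *m D.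
  apply: mulmx_ext => y; rewrite mulmxBl -!mulmxA -scalemxAl !Rop_mul dD DX.
  by rewrite linearZr_LR addrC addKr.
have := innerM_bracket (Rop lambda X) DR.
rewrite -RD -[a *: _]addr0 innerM_linear => /eqP.
by rewrite {2}/innerM mul0mx mxtrace0 addr0 mulf_eq0 (negPf a0) => /eqP.
Qed.

Variable ipn : {dot 'cV[C]_(p + m) for Num.conj}.
Hypothesis ipnE :
  forall A B X Y, ipn (col_mx A X) (col_mx B Y) = g A B + ip X Y.
Hypothesis D_inj : forall x : 'cV[C]_m, x != 0 -> D *m x != 0.

Let innerM_strconst Em (S T : 'M[C]_m) : orthonormal_basis ip Em ->
  innerM ip S T = \sum_j \sum_k
    ip (S *m col j Em) (col k Em) * Num.conj (ip (T *m col j Em) (col k Em)).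
Proof.
move=> oEm; rewrite (innerM_trace S T oEm) exchange_big /=.
apply: eq_bigr => k _; rewrite mxE; apply: eq_bigr => j _.
by rewrite -!(entry_basis _ _ _ oEm); congr (_ * _); rewrite 2!mxE.
Qed.

(** By Parseval the two sides are inner products of images of basis vectors under the adjoint of [S]
    and under [S]; normality equates them. *)
Let normal_strconst Em S a b : orthonormal_basis ip Em ->
  comm_mx S (adj ip S) ->
  \sum_j ip (S *m col j Em) (col a Em) * Num.conj (ip (S *m col j Em) (col b Em)) =
  \sum_k ip (S *m col b Em) (col k Em) * Num.conj (ip (S *m col a Em) (col k Em)).
Proof.
move=> oEm nS.
transitivity (ip (adj ip S *m col b Em) (adj ip S *m col a Em)).
  rewrite (parseval _ _ oEm); apply: eq_bigr => j _.
  by rewrite -!adjPr (dotC _ (col b Em)) (dotC _ (col a Em)) conjCK mulrC.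
by rewrite -adjPr mulmxA nS -mulmxA -adjP (parseval _ _ oEm).
Qed.

Lemma Mop_extension : Mop ipn mu = (c%:C)%:M + block_mx 0 0 0 D.
Proof.
have [ipa ipaE] := exists_dot_abelian.
have [Ea oEa] := exists_orthonormal_basis ipa.
have [Em [oEm [a DE]]] := eigenbasis_hermitian decomp_hermitian.
(* Nonzero eigenvalues are what the orthogonality lemmas for the mixed block require. *)
have a0 i : (a i)%:C != 0.
  have Ei : col i Em != 0.
    apply/eqP => Ei; have := oEm i i; rewrite Ei linear0l eqxx.
    by move/eqP; rewrite eq_sym oner_eq0.
  by apply: contra (D_inj Ei) => /eqP ai; rewrite DE ai scale0r.
pose En := block_mx Ea 0 0 Em.
have g0l A : g 0 A = 0 by rewrite -ipaE linear0l.
have g0r A : g A 0 = 0 by rewrite -ipaE linear0r.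
have oEn : orthonormal_basis ipn En.
  move=> i j; case: (split_ordP i) => i' ->; case: (split_ordP j) => j' ->;
    rewrite ?col_block_lshift ?col_block_rshift ipnE.
  - by rewrite linear0l addr0 -ipaE oEa eq_lshift.
  - by rewrite g0r linear0l addr0 eq_lrshift.
  - by rewrite g0l linear0r addr0 eq_rlshift.
  - by rewrite g0l add0r oEm eq_rshift.
have uEn := orthonormal_basis_unit oEn.
pose L i j k := ip (Lop Lr (col i Ea) *m col j Em) (col k Em).
pose Q i j k := ip (Rop Rr (col i Ea) *m col j Em) (col k Em).
pose s := strconst ip Em lambda.
pose cn := strconst ipn En mu.
have c_ll i j k : cn (lshift m i) (lshift m j) k = 0.
  rewrite /cn /strconst !col_block_lshift muE !linear0l linear0r.
  by rewrite !addr0 col_mx0 linear0l.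
have c_l i j k : cn i j (lshift m k) = 0.
  rewrite /cn /strconst col_block_lshift -[col i En]vsubmxK -[col j En]vsubmxK.
  by rewrite muE ipnE g0l linear0r addr0.
have c_lr i j k : cn (lshift m i) (rshift p j) (rshift p k) = L i j k.
  rewrite /cn /strconst col_block_lshift !col_block_rshift muE ipnE g0l add0r.
  by rewrite linear0l linear0l !addr0 /L Lop_mul.
have c_rl i j k : cn (rshift p j) (lshift m i) (rshift p k) = Q i j k.
  rewrite /cn /strconst col_block_lshift !col_block_rshift muE ipnE g0l add0r.
  by rewrite linear0l linear0r add0r addr0 /Q Rop_mul.
have c_rr i j k : cn (rshift p i) (rshift p j) (rshift p k) = s i j k.
  rewrite /cn /strconst !col_block_rshift muE ipnE g0l add0r.
  by rewrite linear0l linear0r !add0r.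
have ur i b : momentmx cn cn (lshift m i) (rshift p b) = 0.
  have sQ : \sum_j \sum_k s j b k * Num.conj (Q i j k) = 0.
    rewrite -[RHS](innerM_Rop_eigen (col i Ea) (a0 b) (DE b)).
    rewrite (innerM_strconst _ _ oEm).
    by apply: eq_bigr => j _; apply: eq_bigr => k _; rewrite Rop_mul.
  have sL : \sum_j \sum_k s b j k * Num.conj (L i j k) = 0.
    rewrite -[RHS](innerM_Lop_eigen (col i Ea) (a0 b) (DE b)).
    rewrite (innerM_strconst _ _ oEm).
    by apply: eq_bigr => j _; apply: eq_bigr => k _; rewrite Lop_mul.
  by rewrite (momentmx_block_ur c_ll c_l c_lr c_rl c_rr) sQ sL addr0 mulr0.
have BE : momentmx cn cn = block_mx (c%:C)%:M 0 0 (momentmx s s).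
  apply/matrixP => i j; case: (split_ordP i) => i' ->; case: (split_ordP j) => j' ->.
  - rewrite block_mxEul (momentmx_block_ul c_ll c_l c_lr c_rl).
    (* The entry is -2 times the sum of the two trace forms, that is c times [g], and [Ea] is
       orthonormal for [g]. *)
    rewrite /L /Q -!(innerM_strconst _ _ oEm).
    have := ipaE (col j' Ea) (col i' Ea); rewrite oEa /g => gE.
    have k0 : (c%:C) != 0 by rewrite fmorph_eq0 lt_eqF.
    rewrite !mxE eq_sym -[RHS]mulr_natr gE.
    have -> : (2 / c)%:C = 2 / c%:C by rewrite rmorphM fmorphV rmorph_nat.
    by do 2!(move: (innerM _ _ _) => ?); field; exact: k0.
  - by rewrite block_mxEur ur mxE.
  (* The lower left block is the conjugate transpose of the upper right one. *)
  - rewrite block_mxEdl -[momentmx cn cn]momentmxH.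
    have -> : (momentmx cn cn)^H (rshift p i') (lshift m j') =
      Num.conj (momentmx cn cn (lshift m j') (rshift p i')) by rewrite 2!mxE.
    by rewrite ur rmorph0 mxE.
  - rewrite block_mxEdr.
    apply: (momentmx_block_dr c_ll c_l c_lr c_rl c_rr) => i1 u v;
    by have [nL nR] := normalLR (col i1 Ea); apply: (normal_strconst _ _ oEm).
have uEm := orthonormal_basis_unit oEm.
apply: (can_inj (mulmxK uEn)).
transitivity (En *m momentmx cn cn).
  by rewrite -(Mop_basis _ oEn) !mulmxA (mulmxV uEn) mul1mx.
have EmM : Em *m momentmx s s = (c%:C)%:M *m Em + D *m Em.
  rewrite -(Mop_basis _ oEm) !mulmxA (mulmxV uEm) mul1mx.
  by case: lambda_cD => _ ->; rewrite mulmxDl.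
rewrite BE scalar_mx_block add_block_mx !mulmx_block.
rewrite !(mulmx0, mul0mx, addr0, add0r) EmM mulmxDl.
by rewrite (scalar_mxC _ Ea).
Qed.


End Extension.

Lemma span_ind (K : fieldType) (V : vectType K) (s : seq V) (P : V -> Prop) v :
  P 0 -> (forall a x y, P x -> P y -> P (a *: x + y)) ->
  (forall x, x \in s -> P x) -> v \in <<s>>%VS -> P v.
Proof.
move=> P0 Pl Ps; rewrite -[s]/(in_tuple s : seq _) => /coord_span ->.
elim/big_rec: _ => // i x _ Px; apply: Pl => //; apply: Ps; exact: mem_nth.
Qed.

(** * The extended derivation, and solvability from the positive grading *)

Section ExtensionAlgebra.
Variables (R : realType) (p m : nat).
Local Notation C := R[i].
Variable ip : {dot 'cV[C]_m for Num.conj}.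
Variable lambda : {bilinear 'cV[C]_m -> 'cV[C]_m -> 'cV[C]_m}.
Variables (c : R) (D : 'M[C]_m).
Hypothesis lambda_cD : Mop_decomp ip lambda c D.
Variable Lr : {bilinear 'cV[C]_p -> 'cV[C]_m -> 'cV[C]_m}.
Variable Rr : {bilinear 'cV[C]_m -> 'cV[C]_p -> 'cV[C]_m}.
Variable mu : {bilinear 'cV[C]_(p + m) -> 'cV[C]_(p + m) -> 'cV[C]_(p + m)}.
Hypothesis muE : forall (A B : 'cV[C]_p) (X Y : 'cV[C]_m),
  mu (col_mx A X) (col_mx B Y) = col_mx 0 (Lr A Y + Rr X B + lambda X Y).

(** With D extended by 0 on the abelian part, the rule on mixed products is commutation with the
    actions, and on C^m it is the rule for lambda. *)
Lemma derivation_extension :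
  (forall A, comm_mx D (Lop Lr A) /\ comm_mx D (Rop Rr A)) ->
  derivation mu (block_mx 0 0 0 D).
Proof.
case: lambda_cD => dD _ D_comm x y; rewrite -[x]vsubmxK -[y]vsubmxK.
move: (usubmx x) (dsubmx x) (usubmx y) (dsubmx y) => A X B Y.
have [DL _] := D_comm A; have [_ DR] := D_comm B.
rewrite !mul_block_col !muE mul_block_col !(mul0mx, mulmx0, add0r).
rewrite linear0l linear0r addr0 add0r add_col_mx addr0; congr (col_mx _ _).
have DLr : D *m Lr A Y = Lr A (D *m Y) by rewrite -!Lop_mul !mulmxA DL.
have DRr : D *m Rr X B = Rr (D *m X) B by rewrite -!Rop_mul !mulmxA DR.
rewrite !mulmxDr dD DLr DRr.
by rewrite -!addrA addrCA; congr (_ + _); rewrite addrCA.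
Qed.

Section Solvable.
Variables (Em : 'M[C]_m) (a : 'I_m -> R) (r : R) (kap : 'I_m -> nat).
Hypothesis oEm : orthonormal_basis ip Em.
Hypothesis DE : forall i, D *m col i Em = (a i)%:C *: col i Em.
Hypothesis raE : forall i, r * a i = (kap i)%:R.
Hypothesis kap_gt0 : forall i, (0 < kap i)%N.

(* v lies in the sum of the eigenspaces of r D for the eigenvalues >= j. *)
Let weight_ge j v := forall i, (kap i < j)%N -> ip v (col i Em) = 0.

(** The product of eigenvectors for a_i and a_j is an eigenvector for a_i + a_j or zero, and D is
    Hermitian, so only components of that eigenvalue occur. *)
Let strconst_weight i j k :
  strconst ip Em lambda i j k != 0 -> kap k = (kap i + kap j)%N.
Proof.
case: lambda_cD => dD _ s0.
have: (a k)%:C * strconst ip Em lambda i j k =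
      ((a i)%:C + (a j)%:C) * strconst ip Em lambda i j k.
  rewrite /strconst -[(a k)%:C]conjCK -dotZr.
  have -> : Num.conj (a k)%:C = (a k)%:C by exact: conjc_real.
  rewrite -DE adjPr (decomp_hermitian lambda_cD) dD !DE linearZl_LR linearZr_LR.
  by rewrite dotDl !dotZl mulrDl.
move=> /(mulIf s0); rewrite -rmorphD => /complexI /(congr1 ( *%R r)).
by rewrite mulrDr !raE -natrD => /eqP; rewrite eqr_nat => /eqP.
Qed.

Let weight_lambda j l v w : weight_ge j v -> weight_ge l w ->
  weight_ge (j + l) (lambda v w).
Proof.
move=> jv lw k kjl; have uE := orthonormal_basis_unit oEm.
have dec u : u = \sum_i ip u (col i Em) *: col i Em.
  rewrite -[LHS](mulKVmx uE) mulmx_colE; apply: eq_bigr => i _.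
  by rewrite (coord_basis _ _ oEm).
rewrite (dec v) (dec w) linear_sumlz dot_suml big1 // => i _.
rewrite linear_sumr dot_suml big1 // => i' _.
rewrite linearZl_LR linearZr_LR !dotZl -/(strconst ip Em lambda i i' k).
have [ij|ij] := ltnP (kap i) j; first by rewrite jv // mul0r.
have [il|il] := ltnP (kap i') l; first by rewrite lw // mul0r mulr0.
have [->|/strconst_weight kE] := eqVneq (strconst ip Em lambda i i' k) 0.
  by rewrite !mulr0.
by move: kjl; rewrite kE ltnNge leq_add.
Qed.

(** One product removes the abelian component and leaves weight at least 1, all weights being
    positive; from then on only lambda acts, and it adds weights. *)
Let derived_weight k v : v \in derived_series mu k.+1 ->
  usubmx v = 0 /\ weight_ge k.+1 (dsubmx v).
Proof.
pose P j (u : 'cV[C]_(p + m)) := usubmx u = 0 /\ weight_ge j (dsubmx u).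
have P0 j : P j 0 by split=> [|i _]; rewrite linear0 ?linear0l.
have Pl j b x y : P j x -> P j y -> P j (b *: x + y).
  move=> [ux wx] [uy wy]; split=> [|i ij]; rewrite linearP /=.
    by rewrite ux uy scaler0 addr0.
  by rewrite dotDl dotZl wx // wy // mulr0 addr0.
rewrite -/(P k.+1 v); elim: k v => [|k IHk] v.
  apply: (span_ind (P0 1%N) (Pl 1%N)) => x /allpairsP[[x1 x2] [_ _ ->]] /=.
  rewrite -[x1]vsubmxK -[x2]vsubmxK muE; split; first by rewrite col_mxKu.
  by move=> i; rewrite ltnS leqNgt kap_gt0.
apply: (span_ind (P0 k.+2) (Pl k.+2)) => x /allpairsP[[x1 x2]].
case=> /= /vbasis_mem/IHk[u1 w1] /vbasis_mem/IHk[u2 w2] ->.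
rewrite -[x1]vsubmxK -[x2]vsubmxK u1 u2 muE linear0l linear0r !add0r.
split; first by rewrite col_mxKu.
rewrite col_mxKd => i ki; apply: (weight_lambda w1 w2).
(* The product has weight at least 2(k+1), hence at least k+2. *)
by apply: leq_trans ki _; rewrite addSnnS leq_addl.
Qed.

Lemma solvable_extension : solvable_alg mu.
Proof.
(* The sum bounds every single weight, so weight at least N+2 leaves no nonzero coordinate. *)
pose N := (\sum_i kap i)%N; exists N.+2; apply/eqP; rewrite -subv0.
apply/subvP => v /derived_weight [uv wv]; rewrite memv0.
rewrite -[v]vsubmxK uv (_ : dsubmx v = 0) ?col_mx0 //.
apply: (@dot_inj _ _ ip) => z; rewrite (parseval _ _ oEm) linear0l big1 // => i _.
by rewrite wv ?mul0r // ltnS /N (bigD1 i) //= -addnS leq_addr.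
Qed.

End Solvable.

End ExtensionAlgebra.

(** * Uniqueness of the decomposition, and spectra of derivations *)

Lemma decomp_unique (R : realType) n (ip : {dot 'cV[R[i]]_n for Num.conj})
    (f : {bilinear 'cV[R[i]]_n -> 'cV[R[i]]_n -> 'cV[R[i]]_n})
    (c c' : R) (D D' : 'M[R[i]]_n) :
  (exists x y, f x y != 0) ->
  Mop_decomp ip f c D -> Mop_decomp ip f c' D' -> D = D'.
Proof.
move=> /(normV2_gt0 ip) N0 fD fD'.
(* The trace of the square of M equals -2cN for either decomposition, and the squared norm N is
   nonzero, so c is determined. *)
have := trace_Mop2 fD; rewrite (trace_Mop2 fD') => /complexI cc'.
have cE : c = c' by have N1 := lt0r_neq0 N0; apply/esym; nra.
case: fD fD' => _ MD [_ MD']; move: MD'; rewrite MD cE.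
exact: addrI.
Qed.

(** [eigenvalue] refers to row vectors, so the column version passes through non-invertibility of A
    - x. *)
Lemma root_char_poly_col (K : fieldType) n (A : 'M[K]_n) (v : 'cV[K]_n) x :
  A *m v = x *: v -> v != 0 -> root (char_poly A) x.
Proof.
move=> Av v0; rewrite -eigenvalue_root_char /eigenvalue kermx_eq0 row_free_unit.
apply: contra v0 => uA; apply/eqP; rewrite -[v](mulKmx uA).
by rewrite mulmxBl Av mul_scalar_mx subrr mulmx0.
Qed.

Lemma root_integral_spectrum (R : realType) n (A : 'M[R[i]]_n)
    (ks : seq int) (ds : seq nat) (v : 'cV[R[i]]_n) x :
  integral_spectrum A ks ds -> A *m v = x *: v -> v != 0 ->
  exists2 k, k \in ks & x = k%:~R.
Proof.
case=> _ _ _ _ chiA Av v0; have := root_char_poly_col Av v0.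
rewrite chiA /root horner_prod => /eqP/eqP; rewrite prodf_seq_eq0 => /hasP[i _].
rewrite /= horner_exp expf_eq0 => /andP[_]; rewrite hornerXsubC subr_eq0 => /eqP ->.
by exists (nth 0 ks i) => //; apply: mem_nth.
Qed.

Lemma char_poly_block0 (K : fieldType) p m (A : 'M[K]_m) :
  char_poly (block_mx (0 : 'M[K]_p) 0 0 A) = 'X ^+ p * char_poly A.
Proof.
rewrite /char_poly /char_poly_mx map_block_mx !map_mx0 scalar_mx_block.
by rewrite opp_block_mx add_block_mx !oppr0 !addr0 det_lblock det_scalar.
Qed.

(** The new eigenvalue 0 precedes the positive ones and leaves the gcd unchanged; the zero block
    contributes the factor 'X to the power [p]. *)
Lemma integral_spectrum_block0 (R : realType) p m (A : 'M[R[i]]_m)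
    (k : int) (ks : seq int) (ds : seq nat) :
  (0 < p)%N -> 0 < k -> integral_spectrum A (k :: ks) ds ->
  integral_spectrum (block_mx (0 : 'M_p) 0 0 A) (0 :: k :: ks) (p :: ds).
Proof.
move=> p0 k0 [sz srt gcd1 pos chiA]; split.
- by rewrite /= sz.
- by rewrite /= k0.
- by rewrite [LHS]/= -/(foldr gcdz 0 (k :: ks)) gcd1 gcd0z.
- by rewrite /= p0.
- by rewrite char_poly_block0 chiA [RHS]big_ord_recl /= subr0.
Qed.
Theorem theorem4p12 (R : realType) (d1 m : nat) (hd1 : (0 < d1)%N)
  (ip : {dot 'cV[R[i]]_m for Num.conj})
  (lambda : {bilinear 'cV[R[i]]_m -> 'cV[R[i]]_m -> 'cV[R[i]]_m})
  (k2 : int) (ks : seq int) (d2 : nat) (ds : seq nat)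
  (c_lambda : R) (D_lambda : 'M[R[i]]_m)
  (hcrit : critical_S ip lambda)
  (htype : has_type ip lambda (k2 :: ks) (d2 :: ds))
  (hk2 : 0 < k2)
  (hM : Mop_decomp ip lambda c_lambda D_lambda)
  (Lrho : {bilinear 'cV[R[i]]_d1 -> 'cV[R[i]]_m -> 'cV[R[i]]_m})
  (Rrho : {bilinear 'cV[R[i]]_m -> 'cV[R[i]]_d1 -> 'cV[R[i]]_m})
  (mu : {bilinear 'cV[R[i]]_(d1 + m) -> 'cV[R[i]]_(d1 + m)
                  -> 'cV[R[i]]_(d1 + m)})
  (hmu : forall (A B : 'cV[R[i]]_d1) (X Y : 'cV[R[i]]_m),
     mu (col_mx A X) (col_mx B Y)
       = col_mx 0 (Lrho A Y + Rrho X B + lambda X Y))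
  (hmuL : symmetric_Leibniz mu)
  (hi : forall A, comm_mx D_lambda (Lop Lrho A) /\ comm_mx D_lambda (Rop Rrho A))
  (hii : forall A, comm_mx (Lop Lrho A) (adj ip (Lop Lrho A))
                /\ comm_mx (Rop Rrho A) (adj ip (Rop Rrho A)))
  (hii' : forall A, A != 0 -> Lop Lrho A != 0 \/ Rop Rrho A != 0) :
  exists ipn : {dot 'cV[R[i]]_(d1 + m) for Num.conj},
    [/\ forall (A B : 'cV[R[i]]_d1) (X Y : 'cV[R[i]]_m),
          ipn (col_mx A X) (col_mx B Y)
            = - (2 / c_lambda)%:C
                * (\tr (Lop Lrho A *m adj ip (Lop Lrho B)) + \tr (Rop Rrho A *m adj ip (Rop Rrho B)))
              + ip X Y,
        critical_S ipn mu,
        solvable_alg mu &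
        has_type ipn mu (0 :: k2 :: ks) (d1 :: d2 :: ds)].
Proof.
case: hcrit => _ [lambda0 _].
have c_lt0 := decomp_lt0 lambda0 hM.
case: htype => c' [D' [hM' [r r_gt0 spec]]].
(* The type carries a decomposition of its own, here identified with the given one. *)
have DD' := decomp_unique lambda0 hM hM'; move: spec; rewrite -DD' => spec {hM'}.
have [Em [oEm [a DE]]] := eigenbasis_hermitian (decomp_hermitian hM).
have Em0 i : col i Em != 0.
  apply/eqP => Ei; have := oEm i i; rewrite Ei linear0l eqxx.
  by move/eqP; rewrite eq_sym oner_eq0.
(* The list of eigenvalues increases from [k2] > 0, so each is a positive integer. This yields both
   the weights [kap] and the injectivity of [D_lambda]. *)
have eig (v : 'cV[R[i]]_m) x : (r%:C *: D_lambda) *m v = x *: v -> v != 0 ->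
    exists k : nat, (0 < k)%N /\ x = k%:R.
  move=> Dv v0; have [k kin ->] := root_integral_spectrum spec Dv v0.
  have k_gt0 : 0 < k.
    move: kin; rewrite inE => /predU1P[-> //|kin].
    case: spec => _ srt _ _ _; apply: lt_trans hk2 _.
    by have /allP /(_ _ kin) := order_path_min lt_trans srt.
  exists `|k|%N; split; first by rewrite absz_gt0 gt_eqF.
  by rewrite -[in LHS](gtz0_abs k_gt0).
have /fin_all_exists [kap kapP] i :
    exists k : nat, (0 < k)%N /\ r%:C * (a i)%:C = k%:R.
  by apply: (eig (col i Em)) => //; rewrite -scalemxAl DE scalerA.
have kap_gt0 i : (0 < kap i)%N by case: (kapP i).
have kapE i : r * a i = (kap i)%:R.
  by apply: complexI; rewrite rmorphM rmorph_nat; case: (kapP i).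
have D_inj (x : 'cV[R[i]]_m) : x != 0 -> D_lambda *m x != 0.
  move=> x0; apply/eqP => Dx; have [k [k0 /eqP]] : exists k : nat,
      (0 < k)%N /\ 0 = k%:R :> R[i].
    by apply: (eig x) => //; rewrite -scalemxAl Dx scaler0 scale0r.
  by rewrite eq_sym pnatr_eq0 => /eqP k1; rewrite k1 in k0.
have [ipn ipnE] := exists_dot_extension lambda0 hM hii'.
exists ipn.
have decomp : Mop_decomp ipn mu c_lambda (block_mx 0 0 0 D_lambda).
  split; first exact: (derivation_extension hM hmu hi).
  exact: (Mop_extension lambda0 hM hmu hi hii hii' ipnE D_inj).
split.
- by move=> A B X Y; rewrite ipnE.
- split=> //; apply: (decomp_critical _ decomp).
  (* As [d1] is positive there is a nonzero vector in the abelian part; it acts nontrivially on one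
     side, which makes mu nonzero. *)
  have A0 : const_mx 1 != 0 :> 'cV[R[i]]_d1.
    apply/eqP => /colP /(_ (Ordinal hd1)); rewrite !mxE => /eqP.
    by rewrite oner_eq0.
  have nonzero q (S : 'M[R[i]]_(q, m)) : S != 0 -> exists Y : 'cV_m, S *m Y != 0.
    move=> S0; apply: contrapT => h; move/eqP: S0; apply.
    apply: mulmx_ext => x; rewrite mul0mx; apply: contrapT => /eqP Sx.
    by apply: h; exists x.
  case: (hii' _ A0) => /nonzero[Y]; rewrite ?Lop_mul ?Rop_mul => Y0.
    exists (col_mx (const_mx 1) 0), (col_mx 0 Y).
    by rewrite hmu linear0l linear0l !addr0 col_mx_eq0 negb_and Y0 orbT.
  exists (col_mx 0 Y), (col_mx (const_mx 1) 0).
  by rewrite hmu linear0l linear0r add0r addr0 col_mx_eq0 negb_and Y0 orbT.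
- exact: (solvable_extension hM hmu oEm DE kapE kap_gt0).
(* The scaling constant of lambda serves again, since the added eigenvalue is 0. *)
- exists c_lambda, (block_mx 0 0 0 D_lambda); split=> //; exists r => //.
  rewrite scale_block_mx !scaler0.
  exact: integral_spectrum_block0.
Qed.
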